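(* Let $\Bbbk$ be a field of characteristic $0$ or strictly greater than $3$. Let $\det_3$ and $\operatorname{per}_3$ be the determinant and the permanent of the generic $3\times 3$ matrix $(x_{i,j})_{1\le i,j\le 3}$, regarded as cubic forms in $\Bbbk[x_{1,1},\dotsc,x_{3,3}]$. Then $$\operatorname{rk}(\det\nolimits_3) \geq \operatorname{crk}(\det\nolimits_3) \geq 14 \qquad\text{and}\qquad \operatorname{rk}(\operatorname{per}_3) \geq \operatorname{crk}(\operatorname{per}_3) \geq 14,$$ where $\operatorname{rk}$ denotes Waring rank and $\operatorname{crk}$ denotes symmetric cactus rank.
   Context: Let $S = \Bbbk[x_1,\dotsc,x_n]$ and let $T = \Bbbk[y_1,\dotsc,y_n]$ (standard graded) act on $S$ with $y_i$ acting as $\partial/\partial x_i$; write $\theta \circ F$ for this action. For a form $F\in S$ of degree $d$, its apolar ideal is $F^\perp = \{\theta \in T : \theta\circ F = 0\}$, a homogeneous ideal. (For matrix variables $x_{i,j}$ the dual variables are $y_{i,j}$.) Waring rank: $\operatorname{rk}(F)$ is the least $r$ such that $F = c_1\ell_1^d+\dotsb+c_r\ell_r^d$ for some $c_i\in\Bbbk$ and linear forms $\ell_i \in S_1$ (or $\infty$ if no such expression exists). Symmetric cactus rank: $\operatorname{crk}(F)$ is the minimum degree of a zero-dimensional, not necessarily reduced, closed subscheme $Z \subset \mathbb{P}(S_1)$ whose saturated defining ideal $I\subset T$ satisfies $I \subseteq F^\perp$. Equivalently, it is the minimum degree of a saturated homogeneous ideal $I\subseteq F^\perp$ with $T/I$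 of Krull dimension one (the degree being the constant value of the Hilbert polynomial of $T/I$). The permanent of $(x_{i,j})_{1\le i,j\le 3}$ is $\sum_{\sigma} x_{1,\sigma(1)}x_{2,\sigma(2)}x_{3,\sigma(3)}$, the sum being over all permutations $\sigma$ of $\{1,2,3\}$. *)

(* Defs.v *)
From HB Require Import structures.
From mathcomp Require Import all_boot all_order all_fingroup all_algebra.
From mathcomp Require Import boolp.
From mathcomp Require Import mpoly ring_quotient.

Set Implicit Arguments.
Unset Strict Implicit.
Unset Printing Implicit Defensive.

Import GRing.Theory.
Local Open Scope ring_scope.

(* Naturals extended by infinity, encoded as [None]. *)
Definition least (P : nat -> Prop) : option nat :=
  match pselect (exists r, `[< P r >]) with
  | left exP => Some (ex_minn exP)
  | right _ => None
  end.

Definition leo (x y : option nat) : bool :=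
  match x, y with
  | _, None => true
  | None, Some _ => false
  | Some a, Some b => (a <= b)%N
  end.

(* Ideals are the bundled boolean predicates of [ring_quotient]; [idealr] and
   [prime_idealr] are proper by definition. *)
Definition has_prime_chain (A : comNzRingType) (m : nat) : Prop :=
  exists P : 'I_m.+1 -> prime_idealr A,
    forall i j : 'I_m.+1, (i < j)%N ->
      {subset P i <= P j} /\ ~ {subset P j <= P i}.

Definition krull_dim (A : comNzRingType) (d : nat) : Prop :=
  has_prime_chain A d /\ forall m, has_prime_chain A m -> (m <= d)%N.

(* The rings S and T are both [{mpoly k[n]}]; arguments named [theta] are
   elements of T. *)
Definition diff_act (k : fieldType) (n : nat) (theta F : {mpoly k[n]}) :
    {mpoly k[n]} :=
  \sum_(m <- msupp theta) theta@_m *: F^`M[m].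

Definition apolar_ideal (k : fieldType) (n : nat) (F : {mpoly k[n]}) :
    {pred {mpoly k[n]}} :=
  fun theta => diff_act theta F == 0.

Definition homogeneous_ideal (k : fieldType) (n : nat)
    (I : idealr {mpoly k[n]}) : Prop :=
  forall theta, theta \in I -> forall d, pihomog mdeg d theta \in I.

(* The monomials of degree N generate the N-th power of the irrelevant ideal. *)
Definition saturated_ideal (k : fieldType) (n : nat)
    (I : idealr {mpoly k[n]}) : Prop :=
  forall theta,
    (exists N, forall m : 'X_{1..n}, mdeg m = N -> 'X_[m] * theta \in I) ->
    theta \in I.

(* [h] is the dimension of (T/I)_d = T_d / I_d; multinomials provides the vector
   space T_d only for a positive number of variables. *)
Definition hilbert_fun (k : fieldType) (n : nat) (I : idealr {mpoly k[n.+1]})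
    (d h : nat) : Prop :=
  exists2 U : {vspace dhomog n.+1 k d},
    (forall theta : dhomog n.+1 k d,
       (theta \in U) = (mpoly_of_dhomog theta \in I)) &
    h = (\dim {: dhomog n.+1 k d} - \dim U)%N.

Definition hilbert_poly (k : fieldType) (n : nat) (I : idealr {mpoly k[n.+1]})
    (P : {poly rat}) : Prop :=
  exists N, forall d, (N <= d)%N ->
    exists2 h, hilbert_fun I d h & P.[d%:R] = h%:R.

(* Waring rank of F regarded as a form of degree d. *)
Definition waring_rank (k : fieldType) (n d : nat) (F : {mpoly k[n]}) :
    option nat :=
  least (fun r =>
    exists (c : 'I_r -> k) (l : 'I_r -> {mpoly k[n]}),
      (forall i, l i \is 1.-homog) /\ F = \sum_(i < r) c i *: l i ^+ d).

(* A zero-dimensional closed subscheme Z of P(S_1) is given by its saturated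
   homogeneous ideal I, with T/I of Krull dimension one; the degree of Z is the
   constant value of the Hilbert polynomial of T/I. *)
Definition cactus_rank (k : fieldType) (n : nat) (F : {mpoly k[n.+1]}) :
    option nat :=
  least (fun r =>
    exists I : idealr {mpoly k[n.+1]},
      [/\ homogeneous_ideal I,
          saturated_ideal I,
          {subset I <= apolar_ideal F},
          krull_dim {ideal_quot I} 1
        & hilbert_poly I (r%:R)%:P]).

Definition generic_mx (k : fieldType) (m : nat) : 'M[{mpoly k[m * m]}]_m :=
  \matrix_(i, j) 'X_(mxvec_index i j).

Definition permanent (R : comNzRingType) (m : nat) (A : 'M[R]_m) : R :=
  \sum_(s : 'S_m) \prod_(i < m) A i (s i).

Definition det3 (k : fieldType) : {mpoly k[3 * 3]} := \det (generic_mx k 3).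

Definition per3 (k : fieldType) : {mpoly k[3 * 3]} := permanent (generic_mx k 3).

(* Main.v *)
Require Import Defs.
From HB Require Import structures.
From mathcomp Require Import all_boot all_order all_fingroup all_algebra.
From mathcomp Require Import boolp.
From mathcomp Require Import ssrcomplements mpoly ring_quotient.

(** Put [F = cubic s], the signed sum over the six permutations; the permanent is
    the case [s = 1] and the determinant is the case [s = -1]. Only [s * s = 1] is
    used below, so that the two cubics are treated together.

    Lower bound. Let [I] be a saturated homogeneous ideal inside the apolar ideal
    of [F], with constant Hilbert polynomial [r]. The generic linear form
    [sum_i t^i y_i] is a nonzerodivisor on [(T/I)[t]], because a zero divisor
    would yield, by McCoy's argument, a nonzero class killed by all the variables.
    Hence the Hilbert function [h] of [T/I] is nondecreasing and bounded by [r]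
    ([leq_codim_part], [codim_part_le_degree]). Suppose [r <= 13]. Since
    [h 1 = 9], it suffices to derive [h 3 <= 8] from [h 2 <= 13].

    The quadrics apolar to [F] form a space of dimension 36, spanned by the 27
    products of two variables in a common row or column and by nine binomials
    [y_ij y_kl - s y_il y_kj]. The torus that scales rows and columns acts on
    these 36 generators through pairwise distinct weights, so that they can be
    ordered by weight. As [I] has codimension at most 13 in degree 2, that is at
    most 4 inside this space, all the generators but at most four are congruent
    modulo [I] to combinations of generators of smaller weight; call the
    exceptional generators removed. Multiply these
    congruences by a variable: a cubic monomial divisible by one of the
    monomial generators that were not removed reduces to smaller weights, and the
    binomials that were not removed identify monomials of the same weight up to
    sign. Thus [T_3] is spanned modulo [I] by the monomials that survive these
    two reductions, and a finite search shows that, whichever generators are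
    removed, at most eight monomials survive ([few_survivors],
    [survivors_span_full], [codim_part_ge14]).

    Comparison of ranks. From a Waring decomposition of a nonzero form, discard
    zero forms and proportional repetitions. The remaining linear forms are
    finitely many distinct points of projective space. Their ideal is saturated,
    is apolar to the form ([diff_act_power]), has the number of points as Hilbert
    polynomial by interpolation ([points_hilbert_poly]), and its quotient has
    Krull dimension one, because a prime containing it contains the ideal of one
    of the points, whose coordinate ring is [k[t]] ([points_krull_dim]). *)

Set Implicit Arguments.
Unset Strict Implicit.
Unset Printing Implicit Defensive.

Import GRing.Theory.
Local Open Scope ring_scope.


(** * Linear algebra *)

Section LinearAlgebra.
Variable K : fieldType.

(** A linearly closed predicate on a finite-dimensional space is a subspace. *)
Lemma subspace_of_pred (V : vectType K) (P : {pred V}) :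
  submod_closed P -> exists U : {vspace V}, forall v, (v \in U) = (v \in P).
Proof.
move=> [P0 Plin].
have PZD a u v : u \in P -> v \in P -> a *: u + v \in P by move=> *; apply: Plin.
suff IHc : forall c (W : {vspace V}),
    (\dim {: V} - \dim W <= c)%N -> {subset W <= P} ->
  exists U : {vspace V}, forall v, (v \in U) = (v \in P).
  by apply: (IHc (\dim {: V}) 0%VS); [rewrite leq_subr | move=> v; rewrite memv0 => /eqP ->].
elim=> [|c IH] W leWc sWP.
  exists W => v; apply/idP/idP => [/sWP // | _].
  have /eqP -> : W == fullv by rewrite eqEdim subvf -subn_eq0 -leqn0.
  exact: memvf.
have [sPW | /existsNP[v /not_implyP[Pv /negP W'v]]] := pselect (forall v, v \in P -> v \in W).
  by exists W => v; apply/idP/idP => [/sWP|/sPW].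
apply: (IH (W + <[v]>)%VS); last first.
  move=> _ /memv_addP[w Ww [_ /vlineP[a ->] ->]].
  rewrite addrC; apply: PZD => //; exact: sWP.
have ltWv : (\dim W < \dim (W + <[v]>))%N.
  rewrite ltn_neqAle dimvS ?addvSl // andbT; apply: contra W'v => /eqP eqd.
  have /eqP eqW : (W == W + <[v]>)%VS by rewrite eqEdim addvSl eqd leqnn.
  by rewrite eqW memvE addvSr.
rewrite leq_subLR in leWc; rewrite leq_subLR; apply: leq_trans leWc _.
by rewrite addnS -addSn leq_add2r.
Qed.

(** A homogeneous linear system over [K[t]] with more unknowns than equations has a
    nonzero solution: pad the matrix with null columns into a singular square one. *)
Lemma polymx_wide_kernel p q (P : 'M[{poly K}]_(p, q)) :
  (q < p)%N -> exists2 v : 'rV[{poly K}]_p, v != 0 & v *m P = 0.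
Proof.
move=> ltqp.
pose A := \matrix_(i < p, j < p) oapp (P i) 0 (insub (val j)).
have detA : \det A = 0.
  rewrite (expand_det_col A (Ordinal ltqp)) big1 // => i _.
  by rewrite mxE /= insubF ?ltnn // mul0r.
have /eqP/det0P[v v_neq0 vA0] := detA; exists v => //.
apply/rowP=> j; move/rowP/(_ (widen_ord (ltnW ltqp) j)): vA0.
rewrite !mxE => sA0; rewrite -[RHS]sA0; apply: eq_bigr => i _.
by rewrite mxE /= insubT //= => lt_jq; congr (_ * P _ _); apply: val_inj.
Qed.

(** A pencil of linear maps [sum_i t^i f_i] that is injective modulo subspaces
    after extending scalars to [K[t]] cannot decrease codimension. The hypothesis
    speaks of vectors [sum_j t^j g_j] through their coefficients. *)
Lemma leq_codim_pencil (V W : vectType K) (U : {vspace V}) (U' : {vspace W})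
    n (f : 'I_n -> 'Hom(V, W)) :
  (forall N (g : 'I_N -> V),
     (forall e, \sum_(i < n) \sum_(j < N | (i + j == e)%N) f i (g j) \in U') ->
     forall j, g j \in U) ->
  (\dim {: V} - \dim U <= \dim {: W} - \dim U')%N.
Proof.
move=> inj_f; rewrite -!dimv_compl leqNgt; apply/negP => lt_dim.
(* In complements of U and U', the pencil becomes a p x q polynomial matrix. *)
set p := \dim U^C in lt_dim; set q := \dim U'^C in lt_dim.
pose b := vbasis U^C; pose c := vbasis U'^C.
pose rho (w : W) (l : 'I_q) := coord c l (w - projv U' w).
have rho_sum I (r : seq I) (P : pred I) (F : I -> W) l :
    rho (\sum_(i <- r | P i) F i) l = \sum_(i <- r | P i) rho (F i) l.
  by rewrite /rho linear_sum -sumrB linear_sum.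
have rhoZ a w l : rho (a *: w) l = a * rho w l.
  by rewrite /rho linearZ -scalerBr linearZ.
have rho0 w : (forall l, rho w l = 0) -> w \in U'.
  move=> rho_w0; have /coord_vbasis := memv_projC U' w.
  rewrite big1 => [/eqP|l _]; last by rewrite [coord _ _ _]rho_w0 scale0r.
  by rewrite subr_eq0 => /eqP ->; apply: memv_proj.
pose P := \matrix_(a < p, l < q) \sum_(i < n) (rho (f i b`_a) l)%:P * 'X^i.
have [v v_neq0 vP0] := polymx_wide_kernel P lt_dim.
pose N := (\max_(a < p) size (v 0%R a))%N.
have vN a j : (N <= j)%N -> (v 0 a)`_j = 0.
  by move=> leNj; rewrite nth_default // (leq_trans _ leNj) // (leq_bigmax a).
pose g (j : 'I_N) := \sum_(a < p) (v 0 a)`_j *: b`_a.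
have gU j : g j \in U.
  apply: inj_f => e; apply: rho0 => l.
  transitivity ((v *m P) 0 l)`_e; last by rewrite vP0 mxE coef0.
  rewrite mxE coef_sum (eq_bigr (fun a => \sum_(i < n)
    \sum_(j < N | (i + j == e)%N) (v 0 a)`_j * rho (f i b`_a) l)); last first.
    move=> a _; rewrite mxE mulr_sumr coef_sum; apply: eq_bigr => i _.
    rewrite mulrA coefMXn; case: ltnP => [lt_ei | le_ie].
      by rewrite big1 // => j' /eqP eij; rewrite -eij ltnNge leq_addr in lt_ei.
    rewrite coefMC; have [ltN | leN] := ltnP (e - i) N; last first.
      rewrite vN // mul0r big1 // => j' /eqP eij; move: leN.
      by rewrite -eij addKn leqNgt ltn_ord.
    rewrite (big_pred1 (Ordinal ltN)) // => j'.
    by rewrite -[RHS](eqn_add2l i) /= subnKC.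
  rewrite rho_sum exchange_big; apply: eq_bigr => i _ /=.
  rewrite rho_sum exchange_big; apply: eq_bigr => j' _ /=.
  rewrite linear_sum rho_sum; apply: eq_bigr => a _ /=.
  by rewrite linearZ rhoZ.
have gj0 j : g j = 0.
  apply/eqP; rewrite -memv0 -(capv_compl U) memv_cap gU.
  by apply: memv_suml => a _; rewrite memvZ // vbasis_mem // mem_nth ?size_tuple.
case/negP: v_neq0; apply/eqP/rowP=> a; rewrite mxE; apply/polyP=> j; rewrite coef0.
have [ltjN | leNj] := ltnP j N; last exact: vN.
have /freeP := basis_free (vbasisP U^C).
by move=> /(_ (fun a => (v 0 a)`_j)) -> //; exact: (gj0 (Ordinal ltjN)).
Qed.

(** In a list of vectors, the number of those that do not lie in [U] plus the
    span of their predecessors is the dimension that the list adds to [U]. *)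
Lemma size_new_vectors (V : vectType K) (U : {vspace V}) (s : nat -> V) m :
  (\dim (U + <<[seq s i | i <- iota 0 m]>>) =
   \dim U + size [seq i <- iota 0 m | s i \notin (U + <<[seq s j | j <- iota 0 i]>>)%VS])%N.
Proof.
elim: m => [|m IH]; first by rewrite span_nil addv0 addn0.
rewrite -addn1 iotaD add0n filter_cat size_cat addnA -IH map_cat span_cat /= addvA.
rewrite span_seq1; set W := (U + _)%VS.
case: ifPn => /= [sW | /negPn sW]; last by rewrite addn0; congr (\dim _); apply/addv_idPl.
rewrite dimv_disjoint_sum ?dim_vline; last first.
  apply/eqP; rewrite -subv0; apply/subvP=> w /memv_capP[Ww /vlineP[a def_w]].
  have [a0 | a_neq0] := eqVneq a 0; first by rewrite def_w a0 scale0r mem0v.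
  by case/negP: sW; rewrite -[s m](scalerK a_neq0) -def_w memvZ.
by have [s0|] := eqVneq (s m) 0; first by rewrite s0 mem0v in sW.
Qed.
End LinearAlgebra.

(** * Hilbert functions of saturated ideals *)

Section Graded.
Variables (k : fieldType) (n : nat).
Implicit Types (d : nat) (I : idealr {mpoly k[n.+1]}).

Local Notation T d := (dhomog n.+1 k d).

Lemma dim_dhomog d : \dim {: T d} = 'C(d + n, d).
Proof. by rewrite dimvf. Qed.

Lemma mulX_homog d (i : 'I_n.+1) (u : T d) : 'X_i * mpoly_of_dhomog u \is d.+1.-homog.
Proof. rewrite -[d.+1]add1n; apply: dhomogM; last exact: dhomog_is_dhomog.
by rewrite dhomogX /= mdeg1. Qed.

Definition mulX_fun d i (u : T d) : T d.+1 := DHomog (mulX_homog i u).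

Lemma mulX_fun_is_linear d i : linear (@mulX_fun d i).
Proof. by move=> a u v; apply: val_inj; rewrite /= mulrDr scalerAr. Qed.

HB.instance Definition _ d i :=
  GRing.isLinear.Build k (T d) (T d.+1) _ (@mulX_fun d i) (@mulX_fun_is_linear d i).

(** Multiplication by a variable, from degree [d] to degree [d.+1]. *)
Definition mulX d i : 'Hom(T d, T d.+1) := linfun (@mulX_fun d i).

Lemma val_mulX d i (u : T d) :
  mpoly_of_dhomog (mulX d i u) = 'X_i * mpoly_of_dhomog u.
Proof. by rewrite lfunE. Qed.

Lemma ideal_part_exists I d :
  exists U : {vspace T d}, forall u, (u \in U) = (mpoly_of_dhomog u \in I).
Proof.
apply: (@subspace_of_pred _ _ [pred u : T d | mpoly_of_dhomog u \in I]).
split=> [|a u v Iu Iv]; rewrite inE ?rpred0 //= rpredD //.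
by rewrite -mul_mpolyC idealMr.
Qed.

(** The degree [d] piece of an ideal. *)
Definition ideal_part I d : {vspace T d} := projT1 (cid (ideal_part_exists I d)).

Lemma mem_ideal_part I d u : (u \in ideal_part I d) = (mpoly_of_dhomog u \in I).
Proof. by rewrite /ideal_part; case: cid => U /= ->. Qed.

(** The Hilbert function of [T/I]. *)
Definition codim_part I d := (\dim {: T d} - \dim (ideal_part I d))%N.

Lemma hilbert_fun_codim I d h : hilbert_fun I d h -> h = codim_part I d.
Proof.
case=> U memU ->; rewrite /codim_part; congr (_ - \dim _)%N.
by apply/vspaceP=> u; rewrite memU mem_ideal_part.
Qed.

Lemma mulX_ideal_part I d i u :
  u \in ideal_part I d -> mulX d i u \in ideal_part I d.+1.
Proof. by rewrite !mem_ideal_part val_mulX; apply: idealMr. Qed.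

Lemma saturated_colon I f :
  saturated_ideal I -> (forall i, 'X_i * f \in I) -> f \in I.
Proof.
move=> satI If; apply: satI; exists 1%N => m /eqP.
by rewrite mdeg_eq1 => /existsP[i /eqP ->].
Qed.

(** The generic linear form [sum_i t^i y_i] is a nonzerodivisor on [(T/I)[t]]
    when [I] is saturated. As in McCoy's theorem, consider the top coefficient of
    an annihilated polynomial: it is killed by the last variable, which lowers the
    degree in [t] and allows an induction. *)
Lemma generic_linear_form_regular I N (g : 'I_N -> {mpoly k[n.+1]}) :
  saturated_ideal I ->
  (forall e, \sum_(i < n.+1) \sum_(j < N | (i + j == e)%N) 'X_i * g j \in I) ->
  forall j, g j \in I.
Proof.
move=> satI.
pose J (P : {poly {mpoly k[n.+1]}}) := forall e, P`_e \in I.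
have JB P Q : J P -> J Q -> J (P - Q).
  by move=> JP JQ e; rewrite coefB rpredB ?JP ?JQ.
have JD P Q : J P -> J Q -> J (P + Q).
  by move=> JP JQ e; rewrite coefD rpredD ?JP ?JQ.
have JM P Q : J Q -> J (P * Q).
  by move=> JQ e; rewrite coefM rpred_sum // => i _; rewrite idealMr ?JQ.
pose l m : {poly {mpoly k[n.+1]}} :=
  \sum_(i < n.+1 | (i < m)%N) ('X_i)%:P * 'X^i.
have lS (m : 'I_n.+1) : (l m.+1 = ('X_m)%:P * 'X^m + l m).
  rewrite /l (bigD1 m) ?ltnS //=; congr (_ + _); apply: eq_bigl => i.
  by rewrite ltnS ltn_neqAle andbC.
have regular s (P : {poly {mpoly k[n.+1]}}) :
    (size P <= s)%N -> J (l n.+1 * P) -> J P.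
  elim: s P => [|s IHs] P szP JlP.
    by move: szP; rewrite leqn0 size_poly_eq0 => /eqP -> e; rewrite coef0 rpred0.
  suff JX : forall i, J (('X_i)%:P * P).
    by move=> e; apply: saturated_colon => // i; have := JX i e; rewrite coefCM.
  (* Killing the variables one at a time, starting with the highest power of t. *)
  have JlmS m (i : 'I_n.+1) : m = i :> nat -> J (l m.+1 * P) -> J (('X_i)%:P * P).
    move=> -> {m} Jl; have IXPs : 'X_i * P`_s \in I.
      have := Jl (i + s)%N; rewrite lS mulrDl coefD -mulrA coefCM.
      rewrite coefXnM ltnNge leq_addr addKn /= /l mulr_suml coef_sum big1 ?addr0 //.
      move=> j lt_ji; rewrite -mulrA coefCM coefXnM.
      case: ltnP => _; rewrite ?mulr0 // nth_default ?mulr0 //.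
      by apply: leq_trans szP _; rewrite ltn_subRL ltn_add2r.
    pose P' := ('X_i)%:P * (P - (P`_s)%:P * 'X^s).
    have JXs : J (('X_i)%:P * ((P`_s)%:P * 'X^s)).
      move=> e; rewrite mulrA -polyCM coefCM coefXn.
      by case: eqP; rewrite ?mulr1 // mulr0 rpred0.
    suff JP' : J P'.
      by rewrite -[P](subrK ((P`_s)%:P * 'X^s)) mulrDr; apply: JD.
    apply: IHs; last first.
      rewrite /P' mulrBr mulrBr; apply: JB; last exact: JM.
      by rewrite mulrCA; apply: JM.
    apply/leq_sizeP=> e le_se; rewrite coefCM coefB coefCM coefXn.
    have [-> | ne_es] := eqVneq e s; first by rewrite mulr1 subrr mulr0.
    rewrite mulr0 subr0 nth_default ?mulr0 // (leq_trans szP) //.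
    by rewrite ltn_neqAle eq_sym ne_es.
  have Jlm m : (m <= n.+1)%N -> J (l (n.+1 - m)%N * P).
    elim: m => [|m IHm] lt_mn; first by rewrite subn0.
    have lt_i : (n.+1 - m.+1 < n.+1)%N by rewrite subSS ltnS leq_subr.
    have def_m : (n.+1 - m = (Ordinal lt_i).+1)%N by rewrite /= -subSn.
    have JlP' := IHm (ltnW lt_mn).
    have := JlmS _ (Ordinal lt_i) erefl; rewrite -def_m => /(_ JlP') JXi.
    have -> : l (n.+1 - m.+1)%N * P =
      l (n.+1 - m)%N * P - 'X^(n.+1 - m.+1) * (('X_(Ordinal lt_i))%:P * P).
      by rewrite def_m lS mulrDl mulrA ['X^_ * _]mulrC addrC addKr.
    by apply: JB => //; exact: JM.
  move=> i; have := Jlm (n.+1 - i.+1)%N (leq_subr _ _).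
  by rewrite subKn //; exact: (JlmS i i erefl).
move=> Ig j; pose P : {poly {mpoly k[n.+1]}} := \sum_(j < N) (g j)%:P * 'X^j.
have coefP e : P`_e = \sum_(j < N | (j == e :> nat)%N) g j.
  rewrite coef_sum [RHS]big_mkcond /=; apply: eq_bigr => i _.
  by rewrite coefCM coefXn eq_sym; case: eqP; rewrite ?mulr1 ?mulr0.
have -> : g j = P`_j by rewrite coefP big_pred1_eq.
apply: (regular _ P (leqnn _)) => e.
suff -> : (l n.+1 * P)`_e = \sum_(i < n.+1) \sum_(j < N | (i + j == e)%N) 'X_i * g j.
  exact: Ig.
rewrite mulr_suml coef_sum; apply: eq_big => [i | i _]; first by rewrite ltn_ord.
rewrite -mulrA coefCM coefXnM -mulr_sumr; congr (_ * _).
case: ltnP => [lt_ei | le_ie].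
  by rewrite big1 // => j' /eqP eij; rewrite -eij ltnNge leq_addr in lt_ei.
by rewrite coefP; apply: eq_bigl => j'; rewrite -[in RHS](subnKC le_ie) eqn_add2l.
Qed.

(** The Hilbert function of a saturated ideal is nondecreasing. *)
Lemma leq_codim_partS I d :
  saturated_ideal I -> (codim_part I d <= codim_part I d.+1)%N.
Proof.
move=> satI; apply: (@leq_codim_pencil _ _ _ _ _ _ (@mulX d)) => N g Ug j.
rewrite mem_ideal_part; move: j; apply: generic_linear_form_regular => // e.
have := Ug e; rewrite mem_ideal_part linear_sum.
suff -> : \sum_(i < n.+1) mpoly_of_dhomog (\sum_(j < N | (i + j == e)%N) mulX d i (g j)) =
    \sum_(i < n.+1) \sum_(j < N | (i + j == e)%N) 'X_i * mpoly_of_dhomog (g j) by [].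
apply: eq_bigr => i _; rewrite linear_sum; apply: eq_bigr => j' _.
exact: val_mulX.
Qed.

Lemma leq_codim_part I d d' :
  saturated_ideal I -> (d <= d')%N -> (codim_part I d <= codim_part I d')%N.
Proof.
move=> satI le_dd'; rewrite -(subnKC le_dd'); elim: (d' - d)%N => [|e IH].
  by rewrite addn0.
by rewrite addnS (leq_trans IH) // leq_codim_partS.
Qed.

(** The Hilbert function of a saturated ideal is bounded by the degree. *)
Lemma codim_part_le_degree I r d :
  saturated_ideal I -> hilbert_poly I (r%:R)%:P -> (codim_part I d <= r)%N.
Proof.
move=> satI [N Nr]; have [h hh rh] := Nr (maxn N d) (leq_maxl _ _).
rewrite hornerC in rh; move/eqP: rh; rewrite Num.Theory.eqr_nat => /eqP ->.
by rewrite (hilbert_fun_codim hh) leq_codim_part ?leq_maxr.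
Qed.

End Graded.

(** * The apolarity action *)

Section DiffAct.
Variables (k : fieldType) (n : nat).
Implicit Types (p q F : {mpoly k[n]}).

Lemma diff_actwE K p F : (msize p <= K)%N ->
  diff_act p F = \sum_(m : 'X_{1..n < K}) p@_m *: F^`M[m].
Proof.
move=> le_pK; pose I : subFinType _ := 'X_{1..n < K}.
rewrite /diff_act (big_mksub I) ?msupp_uniq //=; first last.
  by move=> x /msize_mdeg_lt /leq_trans; apply.
rewrite big_rmcond //= => j /memN_msupp_eq0 ->.
by rewrite scale0r.
Qed.

Lemma diff_act_is_linear F : linear (fun p => diff_act p F).
Proof.
move=> a p q; pose K := maxn (msize (a *: p + q)) (maxn (msize p) (msize q)).
rewrite !(@diff_actwE K) ?leq_max ?leqnn ?orbT //.
rewrite scaler_sumr -big_split; apply: eq_bigr => m _ /=.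
by rewrite mcoeffD mcoeffZ scalerDl scalerA.
Qed.

Lemma diff_actD p q F : diff_act (p + q) F = diff_act p F + diff_act q F.
Proof. by have := diff_act_is_linear F 1 p q; rewrite !scale1r. Qed.

Lemma diff_act0 F : diff_act 0 F = 0.
Proof. by rewrite /diff_act msupp0 big_nil. Qed.

Lemma diff_actZ a p F : diff_act (a *: p) F = a *: diff_act p F.
Proof. by have := diff_act_is_linear F a p 0; rewrite diff_act0 !addr0. Qed.

Lemma diff_actX m F : diff_act 'X_[m] F = F^`M[m].
Proof. by rewrite /diff_act msuppX big_seq1 mcoeffX eqxx scale1r. Qed.

Lemma diff_act_linearr p : linear (diff_act p).
Proof.
move=> a F G; rewrite /diff_act scaler_sumr -big_split; apply: eq_bigr => m _ /=.
by rewrite mderivmD mderivmZ scalerDr !scalerA mulrC.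
Qed.

HB.instance Definition _ p :=
  GRing.isLinear.Build k {mpoly k[n]} {mpoly k[n]} _ (diff_act p) (diff_act_linearr p).

Lemma diff_actM p q F : diff_act (p * q) F = diff_act p (diff_act q F).
Proof.
elim/mpolyind: p => [|a m p _ _ IHp]; first by rewrite mul0r !diff_act0.
rewrite mulrDl !diff_actD -{}IHp; congr (_ + _).
rewrite -scalerAl !diff_actZ; congr (_ *: _).
elim/mpolyind: q => [|b m' q _ _ IHq]; first by rewrite mulr0 !diff_act0 linear0.
rewrite mulrDr !diff_actD linearD {}IHq; congr (_ + _).
by rewrite -scalerAr !diff_actZ linearZ -mpolyXD /= !diff_actX addmC mderivmDm.
Qed.

Lemma diff_actXU i F : diff_act 'X_i F = F^`M(i).
Proof. by rewrite diff_actX mderivmU1m. Qed.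

End DiffAct.

(** * Cubic monomials surviving the removal of few generators *)

Section Combinatorics.
Local Open Scope nat_scope.

Section FewSatisfied.
Variable K : nat.

Definition keep_small b (it : seq (seq nat)) := [seq c <- it | size c <= b].
Definition leave_out g (it : seq (seq nat)) := [seq c <- it | head g.+1 c != g].
Definition put_in g (it : seq (seq nat)) :=
  [seq if head g.+1 c == g then behead c else c | c <- it].
Definition prune b items : seq (seq (seq nat)) :=
  [seq it <- map (keep_small b) items | it != [::]].

(** An item is a disjunction of clauses, and a clause is an increasing sequence of
    numbers, all of which must belong to a set for the clause to hold. This search
    decides for [g], [g + 1], ... whether they belong to the set, which may contain
    at most [b] of them, and checks that at most [K] items can hold. A branch is
    closed as soon as at most [K] items are left. *)
Fixpoint few_satisfied n g b (items : seq (seq (seq nat))) : bool :=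
  let its := prune b items in
  if size its <= K then true else
  if n is n'.+1 then
    few_satisfied n' g.+1 b (map (leave_out g) its) &&
    (if b is b'.+1 then few_satisfied n' g.+1 b' (map (put_in g) its) else true)
  else false.

Definition clause_from g (c : seq nat) := sorted ltn c && all (leq g) c.

Definition satisfied (xs : seq nat) (it : seq (seq nat)) :=
  has (all (fun v => v \in xs)) it.

Lemma count_geS g (xs : seq nat) : uniq xs ->
  count (leq g) xs = (g \in xs) + count (leq g.+1) xs.
Proof.
move=> uxs; rewrite -(count_uniq_mem g uxs) -count_predUI.
rewrite [X in _ + X](_ : _ = 0) ?addn0; last first.
  apply/eqP; rewrite -leqn0 leqNgt -has_count; apply/hasPn => x _ /=.
  by apply/negP=> /andP[/eqP->]; rewrite ltnn.
by apply: eq_count => x /=; rewrite leq_eqVlt eq_sym.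
Qed.

Lemma sub_in_count (T : eqType) (a1 a2 : pred T) (s : seq T) :
  {in s, forall x, a1 x -> a2 x} -> count a1 s <= count a2 s.
Proof.
elim: s => //= x s IHs sub12; apply: leq_add.
  by have := sub12 x (mem_head _ _); case: (a1 x) => // ->.
by apply: IHs => y sy; apply: sub12; rewrite inE sy orbT.
Qed.

Lemma clause_fromS g c : head g.+1 c != g -> clause_from g c -> clause_from g.+1 c.
Proof.
case: c => [|x c] //= ne_xg /andP[/= px /andP[le_gx _]]; apply/andP; split=> //=.
have lt_gx : g < x by rewrite ltn_neqAle eq_sym ne_xg.
rewrite lt_gx /=; apply: sub_all (order_path_min ltn_trans px) => y /=.
exact: leq_trans.
Qed.

Lemma count_prune g b items (xs : seq nat) :
  all (all (clause_from g)) items -> uniq xs -> count (leq g) xs <= b ->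
  count (satisfied xs) items <= count (satisfied xs) (prune b items).
Proof.
move=> /allP from_g uxs le_b; rewrite count_filter count_map.
apply: sub_in_count => it /from_g/allP it_g /hasP[c it_c xs_c].
have small_c : c \in keep_small b it.
  rewrite mem_filter it_c andbT; have /andP[srt_c /allP c_g] := it_g c it_c.
  apply: leq_trans le_b; rewrite -size_filter.
  apply: uniq_leq_size => [|x cx]; first exact: sorted_uniq ltn_trans ltnn _ srt_c.
  by rewrite mem_filter c_g //; apply: (allP xs_c).
by apply/andP; split; [apply/hasP; exists c | case: (keep_small b it) small_c].
Qed.

Lemma few_satisfiedP n g b items (xs : seq nat) :
  few_satisfied n g b items -> all (all (clause_from g)) items ->
  uniq xs -> count (leq g) xs <= b -> count (satisfied xs) items <= K.
Proof.
move=> few from_g uxs le_b; elim: n g b items few from_g le_b => [|n IHn] g b items;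
  rewrite [few_satisfied _ _ _ _]/= => few from_g le_b;
  apply: leq_trans (count_prune from_g uxs le_b) _;
  case: ifP few => [/(leq_trans (count_size _ _)) // | _] //.
have {}from_g it c : it \in prune b items -> c \in it -> clause_from g c.
  rewrite mem_filter => /andP[_ /mapP[it0 it0_in ->]]; rewrite mem_filter => /andP[_].
  by apply/allP/(allP from_g).
move: (prune b items) from_g => its from_g /andP[few_out few_in].
have gS := count_geS g uxs; case gxs : (g \in xs) gS => gS; rewrite gS in le_b.
- case: b le_b few_in {few_out} => // b le_b few_in.
  apply: leq_trans (IHn _ _ _ few_in _ le_b); last first.
    apply/allP=> _ /mapP[it it_in ->]; apply/allP=> _ /mapP[c c_in ->].
    have c_g := from_g _ _ it_in c_in; case: ifP => [|/negbT ne_cg]; last exact: clause_fromS.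
    case: c c_g {c_in} => [/= _|x c /= /andP[/= px /andP[_ c_g]] /eqP def_x].
      by rewrite eqn_leq ltnn.
    by rewrite /clause_from (path_sorted px) -def_x; apply: order_path_min px; apply: ltn_trans.
  rewrite count_map; apply: sub_count => it /hasP[c it_c xs_c].
  apply/hasP; exists (if head g.+1 c == g then behead c else c).
    by apply/mapP; exists c.
  by case: ifP => // _; case: c xs_c {it_c} => //= x c /andP[].
- apply: leq_trans (IHn _ _ _ few_out _ le_b); last first.
    apply/allP=> _ /mapP[it it_in ->]; apply/allP=> c; rewrite mem_filter => /andP[ne_cg c_in].
    exact: clause_fromS ne_cg (from_g _ _ it_in c_in).
  rewrite count_map; apply: sub_count => it /hasP[c it_c xs_c].
  apply/hasP; exists c => //; rewrite mem_filter it_c andbT.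
  case: c xs_c {it_c} => [_|x c /= /andP[xs_x _]]; first by rewrite /= eqn_leq ltnn.
  by apply/eqP=> def_x; rewrite -def_x xs_x in gxs.
Qed.

End FewSatisfied.

(** The cells of the matrix are numbered row by row: cell [c] lies in row [c %/ 3]
    and column [c %% 3]. Two cells are collinear if they share a row or a column. *)
Definition collinear a b := (a %/ 3 == b %/ 3) || (a %% 3 == b %% 3).

(** The cell in the row of [a] and the column of [b]. *)
Definition corner a b := a %/ 3 * 3 + b %% 3.

(** The cell in the remaining row and column, for cells that are not collinear. *)
Definition third a b := (3 - a %/ 3 - b %/ 3) * 3 + (3 - a %% 3 - b %% 3).

(** Weights for a one-parameter subgroup of the torus that scales rows and
    columns. The sums of two elements of {0, 1, 3} are distinct and less than 7;
    hence the product of two variables has the same weight as another one only if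
    both are the two diagonals of a 2 x 2 submatrix. *)
Definition weight c := nth 0 [:: 0; 1; 3] (c %/ 3) + 7 * nth 0 [:: 0; 1; 3] (c %% 3).
Definition pair_weight p := weight p.1 + weight p.2.

(** The quadratic and cubic monomials, as sorted pairs and triples of cells. *)
Definition pairs := [seq p <- [seq (a, b) | a <- iota 0 9, b <- iota 0 9] | p.1 <= p.2].
Definition triples :=
  [seq t <- [seq (a, p) | a <- iota 0 9, p <- pairs] | t.1 <= t.2.1].

(** The factorizations of a cubic monomial into a variable and a pair. *)
Definition splits (t : nat * (nat * nat)) :=
  let: (a, (b, c)) := t in [:: (a, (b, c)); (b, (a, c)); (c, (a, b))].

Definition triple_sort (t : nat * (nat * nat)) : nat * (nat * nat) :=
  let: (a, (b, c)) := t in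
  if sort leq [:: a; b; c] is [:: a'; b'; c'] then (a', (b', c')) else t.

Definition triple_code (t : nat * (nat * nat)) := t.1 * 81 + t.2.1 * 9 + t.2.2.
Definition triple_weight t := weight t.1 + pair_weight t.2.

(** The weights of the monomial generators that divide [t]. *)
Definition monomial_weights t :=
  [seq pair_weight s.2 | s <- splits t & collinear s.2.1 s.2.2].

(** The monomials linked to [t] by a variable times a binomial generator, with
    the weight of that generator. *)
Definition neighbours t :=
  [seq (pair_weight s.2, triple_sort (s.1, (corner s.2.1 s.2.2, corner s.2.2 s.2.1)))
  | s <- splits t & ~~ collinear s.2.1 s.2.2].

(** A monomial [t] survives the removal of the generators with weights [xs] if no
    monomial generator that is left divides [t], and if for each neighbour either
    the linking binomial is removed, or the neighbour is not smaller than [t] and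
    is not divisible by a monomial generator that is left. The disjunctive normal
    form of this condition is [survival_clauses t]. *)
Definition distribute (acc opts : seq (seq nat)) := [seq c ++ o | c <- acc, o <- opts].
Arguments distribute : simpl never.
Definition survival_options t (vt : nat * (nat * (nat * nat))) :=
  [:: vt.1] ::
  (if triple_code t <= triple_code vt.2 then [:: monomial_weights vt.2] else [::]).
Definition survival_clauses t : seq (seq nat) :=
  foldr (fun vt acc => distribute acc (survival_options t vt))
    [:: monomial_weights t] (neighbours t).
Definition survives (xs : seq nat) t := satisfied xs (survival_clauses t).

Definition survival_table :=
  [seq [seq sort leq (undup c) | c <- survival_clauses t] | t <- triples].

Lemma few_survival_table : few_satisfied 8 49 0 4 survival_table.
Proof. by vm_compute. Qed.

Lemma survival_table_from0 : all (all (clause_from 0)) survival_table.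
Proof. by vm_compute. Qed.

Lemma few_survivors (xs : seq nat) :
  uniq xs -> size xs <= 4 -> count (survives xs) triples <= 8.
Proof.
move=> uxs le_xs4; have le_count := leq_trans (count_size (leq 0) xs) le_xs4.
apply: leq_trans (few_satisfiedP few_survival_table survival_table_from0 uxs le_count).
rewrite /survival_table; move: triples => ts; rewrite count_map.
apply: sub_count => t /hasP[c c_t xs_c].
apply/hasP; exists (sort leq (undup c)); first by apply/mapP; exists c.
by rewrite /= (@eq_all_r _ _ c) // => x; rewrite mem_sort mem_undup.
Qed.

Lemma not_survives (xs : seq nat) t : ~~ survives xs t ->
  ~~ all (fun v => v \in xs) (monomial_weights t) \/
  exists v t', [/\ (v, t') \in neighbours t, v \notin xs &
    (triple_code t' < triple_code t) \/ ~~ all (fun v => v \in xs) (monomial_weights t')].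
Proof.
case: (boolP (all _ _)) => [xs_t | _ _]; last by left.
rewrite /survives /satisfied /survival_clauses => not_sat; right; move: not_sat.
elim: (neighbours t) => [|[v t'] nbs IHnbs] /=; first by rewrite orbF xs_t.
have IHnbs' : ~~ has (all (fun v => v \in xs))
    (foldr (fun vt acc => distribute acc (survival_options t vt)) [:: monomial_weights t] nbs) ->
  exists u t1, [/\ (u, t1) \in (v, t') :: nbs, u \notin xs &
    (triple_code t1 < triple_code t) \/ ~~ all (fun v => v \in xs) (monomial_weights t1)].
  by case/IHnbs=> u [t1 [t1_in *]]; exists u, t1; split=> //; rewrite inE t1_in orbT.
move=> not_sat; have [xs_v | xs'v] := boolP (v \in xs); last first.
  have [lt_c | le_c] := ltnP (triple_code t') (triple_code t).
    by exists v, t'; rewrite mem_head; split=> //; left.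
  have [xs_t' | xs't'] := boolP (all (fun v => v \in xs) (monomial_weights t')); last first.
    by exists v, t'; rewrite mem_head; split=> //; right.
  apply/IHnbs'/(contra _ not_sat) => /hasP[c c_in xs_c].
  apply/hasP; exists (c ++ monomial_weights t').
    by apply: allpairs_f => //; rewrite /survival_options le_c !inE eqxx orbT.
  by rewrite all_cat xs_c.
apply/IHnbs'/(contra _ not_sat) => /hasP[c c_in xs_c]; apply/hasP; exists (c ++ [:: v]).
  by apply: allpairs_f => //; rewrite mem_head.
by rewrite all_cat xs_c /= xs_v.
Qed.

(** The generator of a given weight is recorded by one of its monomials. *)
Definition pair_of v := ohead [seq p <- pairs | pair_weight p == v].

(** Two cells that lie in neither the row nor the column of [e]. *)
Definition opposite e : nat * nat :=
  ((e %/ 3 + 1) %% 3 * 3 + (e %% 3 + 1) %% 3, (e %/ 3 + 2) %% 3 * 3 + (e %% 3 + 2) %% 3).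

(** Whether [a] and [b] lie on a common broken diagonal parallel to the main one. *)
Definition cyclic_pair a b := (a %% 3 + b %/ 3) %% 3 == (a %/ 3 + b %% 3) %% 3.

Lemma forall_pair (P : nat -> nat -> bool) :
  all (fun a => all (P a) (iota 0 9)) (iota 0 9) ->
  forall a b, a < 9 -> b < 9 -> P a b.
Proof.
move=> /allP P9 a b lta ltb; have := P9 a; rewrite mem_iota => /(_ lta)/allP.
by apply; rewrite mem_iota.
Qed.

Lemma forall_triple (P : nat -> nat -> nat -> bool) :
  all (fun a => all (fun b => all (P a b) (iota 0 9)) (iota 0 9)) (iota 0 9) ->
  forall a b c, a < 9 -> b < 9 -> c < 9 -> P a b c.
Proof.
move=> /forall_pair P9 a b c lta ltb ltc; have /allP := P9 a b lta ltb.
by apply; rewrite mem_iota.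
Qed.

Lemma pair_of_collinear a b : a < 9 -> b < 9 -> collinear a b ->
  pair_of (pair_weight (a, b)) \in [:: Some (a, b); Some (b, a)].
Proof.
move=> lta ltb; apply/implyP; move: a b lta ltb; apply: forall_pair.
by vm_compute.
Qed.

Lemma pair_of_noncollinear a b : a < 9 -> b < 9 -> ~~ collinear a b ->
  pair_of (pair_weight (a, b)) \in
    [:: Some (a, b); Some (b, a); Some (corner a b, corner b a); Some (corner b a, corner a b)].
Proof.
move=> lta ltb; apply/implyP; move: a b lta ltb; apply: forall_pair.
by vm_compute.
Qed.

Lemma corner_facts a b : a < 9 -> b < 9 ->
  [&& corner a b < 9, pair_weight (a, b) < 49,
     corner (corner a b) (corner b a) == a,
     pair_weight (corner a b, corner b a) == pair_weight (a, b),
     collinear (corner a b) (corner b a) == collinear a b,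
     collinear a b || (third (corner a b) (corner b a) == third a b),
     collinear a b || (cyclic_pair (corner a b) (corner b a) == ~~ cyclic_pair a b) &
     collinear a b || (third a b < 9)].
Proof. by move: a b; apply: forall_pair; vm_compute. Qed.

Lemma opposite_facts e : e < 9 ->
  [&& (opposite e).1 < 9, (opposite e).2 < 9, ~~ collinear (opposite e).1 (opposite e).2
    & third (opposite e).1 (opposite e).2 == e].
Proof.
move=> lte; pose P e := [&& (opposite e).1 < 9, (opposite e).2 < 9,
  ~~ collinear (opposite e).1 (opposite e).2 & third (opposite e).1 (opposite e).2 == e].
have /allP : all P (iota 0 9) by vm_compute.
by apply; rewrite mem_iota.
Qed.

Lemma triple_sort_triples a b c : a < 9 -> b < 9 -> c < 9 ->
  triple_sort (a, (b, c)) \in triples.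
Proof. by move: a b c; apply: forall_triple; vm_compute. Qed.

Lemma mem_pairs p : p \in pairs -> p.1 < 9 /\ p.2 < 9.
Proof.
rewrite mem_filter => /andP[_ /allpairsP[[a b] [+ + ->]]].
by rewrite !mem_iota.
Qed.

Lemma mem_triples t : t \in triples -> [/\ t.1 < 9, t.2.1 < 9 & t.2.2 < 9].
Proof.
rewrite mem_filter => /andP[_ /allpairsP[[a p] [+ /mem_pairs[p1 p2] ->]]].
by rewrite mem_iota.
Qed.

Lemma pair_ofP v a b :
  pair_of v = Some (a, b) -> [/\ a < 9, b < 9 & pair_weight (a, b) = v].
Proof.
rewrite /pair_of => def_p; have : (a, b) \in [seq p <- pairs | pair_weight p == v].
  by case: filter def_p => //= p ps [->]; rewrite mem_head.
by rewrite mem_filter => /andP[/eqP <- /mem_pairs[]].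
Qed.

Lemma triple_sort_perm a b c : exists a' b' c',
  triple_sort (a, (b, c)) = (a', (b', c')) /\ perm_eq [:: a; b; c] [:: a'; b'; c'].
Proof.
rewrite /triple_sort; have := size_sort leq [:: a; b; c]; have := permEl (perm_sort leq [:: a; b; c]).
case: sort => [|a' [|b' [|c' [|? ?]]]] //= pe _; exists a', b', c'; split=> //.
by rewrite perm_sym.
Qed.

Lemma triple_weight_sort a b c :
  triple_weight (triple_sort (a, (b, c))) = triple_weight (a, (b, c)).
Proof.
have [a' [b' [c' [-> /(perm_map weight)/perm_sumn]]]] := triple_sort_perm a b c.
by rewrite /triple_weight /pair_weight /= !addn0.
Qed.

Lemma mem_splits t u : t \in splits u ->
  perm_eq [:: u.1; u.2.1; u.2.2] [:: t.1; t.2.1; t.2.2].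
Proof.
case: u => a [b c]; rewrite !inE => /or3P[] /eqP-> //=.
  exact: permEl (perm_catCA [:: a] [:: b] [:: c]).
exact: permEl (perm_catC [:: a; b] [:: c]).
Qed.

End Combinatorics.

(** * The determinantal and permanental cubics *)

(** The index of the variable in row [c %/ 3] and column [c %% 3]. *)
Definition cell (c : nat) : 'I_9 :=
  mxvec_index (inord (c %/ 3) : 'I_3) (inord (c %% 3) : 'I_3).

Lemma cell_inj : {in gtn 9 &, injective cell}.
Proof.
move=> a b; rewrite !inE => lta ltb eq_ab.
have [g gK _] := curry_mxvec_bij 3 3.
have /(congr1 g) : uncurry (@mxvec_index 3 3) (inord (a %/ 3), inord (a %% 3)) =
  uncurry (@mxvec_index 3 3) (inord (b %/ 3), inord (b %% 3)) by [].
rewrite !gK ?inE // => -[/(congr1 val) + /(congr1 val)].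
rewrite /= !inordK ?ltn_mod // ?ltn_divLR // => eqd eqm.
by rewrite (divn_eq a 3) (divn_eq b 3) eqd eqm.
Qed.

Lemma cell_surj (i : 'I_9) : exists2 c, (c < 9)%N & i = cell c.
Proof.
case: (@mxvec_indexP 3 3 i) => r c.
have c_lt : (r * 3 + c < 9)%N.
  by case: r c => [[|[|[|r]]] r_lt] [[|[|[|c]]] c_lt].
exists (r * 3 + c)%N => //.
by rewrite /cell divnMDl // divn_small // addn0 modnMDl modn_small // !inord_val.
Qed.

Section Cubic.
Variables (k : fieldType) (s : k).

Local Notation x c := ('X_(cell c) : {mpoly k[9]}).

(** The six monomials of a 3 x 3 determinant, with sign [s] on the odd
    permutations: [cubic 1] is the permanent, [cubic (-1)] the determinant, by
    [per3_cubic] and [det3_cubic] below. *)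
Definition cubic : {mpoly k[9]} :=
  x 0 * x 4 * x 8 + x 1 * x 5 * x 6 + x 2 * x 3 * x 7
  + s *: (x 0 * x 5 * x 7 + x 1 * x 3 * x 8 + x 2 * x 4 * x 6).

(** The second derivatives of [cubic] ([cubic_hessian]). *)
Definition hessian a b : {mpoly k[9]} :=
  if collinear a b then 0
  else (if cyclic_pair a b then 1 else s) *: x (third a b).

Lemma mderiv_cell a c : (a < 9)%N -> (c < 9)%N -> (x c)^`M(cell a) = (a == c)%:R.
Proof.
move=> lta ltc; rewrite mderivX mnm1E (inj_in_eq cell_inj) ?inE // eq_sym.
case: eqP => [->|_]; last by rewrite scale0r.
by rewrite -[X in (X - _)%MM]add0m addmK mpolyX0 scale1r.
Qed.

Lemma mderiv_cell2 a p q : (a < 9)%N -> (p < 9)%N -> (q < 9)%N ->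
  (x p * x q)^`M(cell a) = (a == p)%:R *: x q + (a == q)%:R *: x p.
Proof.
move=> lta ltp ltq; rewrite mderivM !mderiv_cell // mulrC.
by case: (a == p); case: (a == q); rewrite ?(mulr0, mulr1, scale0r, scale1r).
Qed.

Lemma cubic_hessian a b : (a < 9)%N -> (b < 9)%N ->
  cubic^`M(cell a)^`M(cell b) = hessian a b.
Proof.
have d9 c : (c < 9)%N -> cubic^`M(cell c) = nth 0
  [:: x 4 * x 8 + s *: (x 5 * x 7); x 5 * x 6 + s *: (x 3 * x 8);
      x 3 * x 7 + s *: (x 4 * x 6); x 2 * x 7 + s *: (x 1 * x 8);
      x 0 * x 8 + s *: (x 2 * x 6); x 1 * x 6 + s *: (x 0 * x 7);
      x 1 * x 5 + s *: (x 2 * x 4); x 2 * x 3 + s *: (x 0 * x 5);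
      x 0 * x 4 + s *: (x 1 * x 3)] c.
  do 9?[case: c => [_ | c]] => //; rewrite /cubic !(mderivD, mderivZ, mderivM, mderiv_cell) //=;
  by rewrite !(mul0r, mulr0, mul1r, mulr1, add0r, addr0) // ?scaler0 ?add0r ?addr0.
move=> lta ltb; rewrite d9 //.
do 9?[case: a lta => [_ | a lta]] => //=; rewrite mderivD mderivZ !mderiv_cell2 //;
  do 9?[case: b ltb => [_ | b ltb]] => //;
  by rewrite /hessian /= ?scale1r ?scale0r ?add0r ?addr0 ?scaler0 ?add0r ?addr0.
Qed.

End Cubic.

Lemma ord3_eq a b : (a < 3)%N -> (b < 3)%N -> (inord a == inord b :> 'I_3) = (a == b).
Proof. by move=> lta ltb; rewrite -val_eqE /= !inordK. Qed.

Lemma big_S3 (M : nmodType) (f : 'S_3 -> M)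
   (t01 := tperm (inord 0) (inord 1) : 'S_3) (t02 := tperm (inord 0) (inord 2) : 'S_3)
   (t12 := tperm (inord 1) (inord 2) : 'S_3) :
  \sum_(t : 'S_3) f t =
    f 1%g + f (t01 * t02)%g + f (t02 * t01)%g + (f t12 + f t01 + f t02).
Proof.
pose S := [:: 1; t01 * t02; t02 * t01; t12; t01; t02]%g.
have uniqS : uniq S.
  apply: (@map_uniq _ _ (fun t : 'S_3 => (t (inord 0), t (inord 1)))).
  by rewrite /S /= !permE /= !permE /= !inE !xpair_eqE /= !ord3_eq //= !ord3_eq.
have [_ memS] : (size S = size (enum 'S_3)) * (S =i enum 'S_3).
  by apply: uniq_min_size => // [t _|]; rewrite ?mem_enum // -cardE card_Sn.
rewrite -big_enum (perm_big S); last by rewrite uniq_perm ?enum_uniq.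
by rewrite /S !big_cons big_nil /= addr0 !addrA.
Qed.

Lemma prod_ord3 (R : comNzRingType) (F : 'I_3 -> R) :
  \prod_i F i = F (inord 0) * F (inord 1) * F (inord 2).
Proof.
rewrite !big_ord_recl big_ord0 mulr1 mulrA.
by congr (F _ * F _ * F _); apply: val_inj; rewrite /= inordK.
Qed.

Lemma generic_mxE k (r c : nat) : (r < 3)%N -> (c < 3)%N ->
  generic_mx k 3 (inord r) (inord c) = 'X_(cell (3 * r + c)).
Proof.
move=> ltr ltc; rewrite mxE /cell; congr ('X_ (mxvec_index _ _)).
  by rewrite mulnC divnMDl // divn_small // addn0.
by rewrite mulnC modnMDl modn_small.
Qed.

Lemma tperm_ord3 a b c : (a < 3)%N -> (b < 3)%N -> (c < 3)%N ->
  tperm (inord a) (inord b) (inord c) =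
    inord (if c == a then b else if c == b then a else c) :> 'I_3.
Proof.
move=> lta ltb ltc; rewrite permE /= !ord3_eq //.
by case: (c == a); case: (c == b).
Qed.

Lemma per3_cubic k : per3 k = cubic 1.
Proof.
rewrite /per3 /permanent big_S3 !prod_ord3 !permM !perm1 !tperm_ord3 //=.
by rewrite !generic_mxE //= /cubic scale1r.
Qed.

Lemma det3_cubic k : det3 k = cubic (-1).
Proof.
rewrite /det3 /determinant big_S3 !odd_permM !odd_tperm !odd_perm1 !ord3_eq //=.
rewrite !prod_ord3 !permM !perm1 !tperm_ord3 //=.
by rewrite !generic_mxE //= /cubic !expr0 !expr1 !mulN1r !mul1r scaleN1r !opprD.
Qed.

(** * Generators of the apolar quadrics *)

Section Generators.
Variables (k : fieldType) (s : k).
Hypothesis ss1 : s * s = 1.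
Local Notation T d := (dhomog 9 k d).
Local Notation x c := ('X_(cell c) : {mpoly k[9]}).
Local Notation F := (cubic s).
Local Notation mulX := (@mulX k 8).

Lemma var_homog i : ('X_i : {mpoly k[9]}) \is 1.-homog.
Proof. by rewrite dhomogX /= mdeg1. Qed.

(** The monomials of degrees 1, 2 and 3, as vectors. *)
Definition y1 c : T 1 := DHomog (var_homog (cell c)).
Definition y2 a b : T 2 := mulX 1 (cell a) (y1 b).
Definition y3 a b c : T 3 := mulX 2 (cell a) (y2 b c).

Lemma val_y2 a b : y2 a b = x a * x b :> {mpoly k[9]}.
Proof. by rewrite /y2 val_mulX. Qed.

Lemma val_y3 a b c : y3 a b c = x a * (x b * x c) :> {mpoly k[9]}.
Proof. by rewrite /y3 val_mulX val_y2. Qed.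

Lemma y2C a b : y2 a b = y2 b a.
Proof. by apply: val_inj; rewrite /= !val_y2 mulrC. Qed.

Lemma y3_perm a b c a' b' c' : perm_eq [:: a; b; c] [:: a'; b'; c'] -> y3 a b c = y3 a' b' c'.
Proof.
move=> pe; apply: val_inj; rewrite /= !val_y3.
have : \prod_(i <- [:: a; b; c]) x i = \prod_(i <- [:: a'; b'; c']) x i by exact: perm_big.
by rewrite !big_cons !big_nil /= !mulr1.
Qed.

(** Induction step for spanning sets: a form of positive degree is a sum of
    multiples of variables. *)
Lemma mulX_generates d (W : {vspace T d.+1}) :
  (forall i u, mulX d i u \in W) -> W = fullv.
Proof.
move=> WX; apply/eqP; rewrite eqEsubv subvf; apply/subvP=> p _.
pose g m : T d.+1 := insubd 0 'X_[m].
have -> : p = \sum_(m <- msupp (val p)) (val p)@_m *: g m.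
  apply: val_inj; rewrite /= linear_sum /= {1}[val p]mpolyE big_seq [RHS]big_seq.
  apply: eq_bigr => m supp_m.
  transitivity ((val p)@_m *: mpoly_of_dhomog (g m)); last by [].
  by rewrite /g insubdK // -topredE /= dhomogX /= (dhomog_mf (dhomog_is_dhomog p)).
rewrite big_seq; apply: memv_suml => m supp_m; apply: memvZ.
have deg_m : mdeg m = d.+1 := dhomog_mf (dhomog_is_dhomog p) supp_m.
have [i mi] : exists i, m i != 0%N.
  apply/existsP; apply: contra_eqT deg_m => /existsPn m0.
  by rewrite mdegE big1 // => i _; apply/eqP/negPn/m0.
have le_im : (U_(i) <= m)%MM by rewrite lep1mP.
have m'_homog : ('X_[m - U_(i)] : {mpoly k[9]}) \is d.-homog.
  have : mdeg ((m - U_(i)) + U_(i)) = d.+1 by rewrite submK.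
  by rewrite mdegD mdeg1 addn1 dhomogX /= => -[->].
suff -> : g m = mulX d i (DHomog m'_homog) by [].
apply: val_inj; rewrite /= val_mulX /g insubdK /=; last by rewrite -topredE /= dhomogX /= deg_m.
by rewrite -mpolyXD addmC submK.
Qed.

Lemma T1_sum (u : T 1) : u = \sum_(i < 9) (val u)@_(U_(i)) *: 'X_i :> {mpoly k[9]}.
Proof.
apply/mpolyP=> m; rewrite raddf_sum /=.
have [/eqP /mdeg1P[j /eqP->] | ne1] := eqVneq (mdeg m) 1%N.
  rewrite (bigD1 j) //= mcoeffZ mcoeffXU eqxx mulr1 big1 ?addr0 // => i ne_ij.
  by rewrite mcoeffZ mcoeffXU (negPf ne_ij) mulr0.
rewrite (dhomog_nemf_coeff (dhomog_is_dhomog u)) // big1 // => i _.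
rewrite mcoeffZ mcoeffX; case: eqP => [def_m|_]; rewrite ?mulr0 //.
by rewrite -def_m mdeg1 in ne1.
Qed.

Lemma linear_forms_generated (W : {vspace T 1}) : (forall c, (c < 9)%N -> y1 c \in W) -> W = fullv.
Proof.
move=> Wy; apply/eqP; rewrite eqEsubv subvf; apply/subvP=> u _.
have -> : u = \sum_(i < 9) (val u)@_(U_(i)) *: DHomog (var_homog i).
  by apply: val_inj; rewrite /= {1}T1_sum linear_sum.
apply: memv_suml => i _; apply: memvZ.
by have [c ltc ->] := cell_surj i; apply: Wy.
Qed.

Lemma cubic_forms_generated (W : {vspace T 3}) :
  (forall a b c, (a < 9)%N -> (b < 9)%N -> (c < 9)%N -> y3 a b c \in W) -> W = fullv.
Proof.
move=> Wy; apply: mulX_generates => i u; have [a lta ->] := cell_surj i.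
suff /vspaceP/(_ u) : (mulX 2 (cell a) @^-1: W)%VS = fullv by rewrite memvf -memv_preim.
apply: mulX_generates => j u1; have [b ltb ->] := cell_surj j; rewrite -memv_preim.
suff /vspaceP/(_ u1) : (mulX 1 (cell b) @^-1: (mulX 2 (cell a) @^-1: W))%VS = fullv.
  by rewrite memvf -!memv_preim.
by apply: linear_forms_generated => c ltc; rewrite -!memv_preim; apply: Wy.
Qed.

(** The generator of weight [v] of the quadrics apolar to the cubic, or 0: the
    product of two collinear variables, or the difference, up to the sign [s], of
    the two diagonals of a 2 x 2 submatrix. *)
Definition gen v : T 2 :=
  if pair_of v is Some (a, b) then
    if collinear a b then y2 a b else y2 a b - s *: y2 (corner a b) (corner b a)
  else 0.

Lemma gen_collinear a b : (a < 9)%N -> (b < 9)%N -> collinear a b ->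
  gen (pair_weight (a, b)) = y2 a b.
Proof.
move=> lta ltb ab; have := pair_of_collinear lta ltb ab; rewrite /gen !inE.
by case/orP=> /eqP ->; rewrite ?ab // /collinear eq_sym [in X in _ || X]eq_sym -/(collinear a b) ab y2C.
Qed.

(** Up to a multiple of their generator, one diagonal of a 2 x 2 submatrix can be
    replaced with the other one, whichever of them [gen] starts from. *)
Lemma gen_noncollinear a b : (a < 9)%N -> (b < 9)%N -> ~~ collinear a b ->
  exists e, y2 a b = s *: y2 (corner a b) (corner b a) + e *: gen (pair_weight (a, b)).
Proof.
move=> lta ltb ab; have := pair_of_noncollinear lta ltb ab; rewrite /gen !inE.
have collC p q : collinear p q = collinear q p by rewrite /collinear eq_sym [in X in _ || X]eq_sym.
have /and5P[_ _ /eqP cab _ /and4P[/eqP cc _ _ _]] := corner_facts lta ltb.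
have /and5P[_ _ /eqP cba _ _] := corner_facts ltb lta.
have cc' : collinear (corner b a) (corner a b) = collinear a b by rewrite collC.
case/or4P=> /eqP ->; rewrite ?cc ?cc' ?[collinear b a]collC (negPf ab).
- by exists 1; rewrite scale1r addrC subrK.
- by exists 1; rewrite scale1r [y2 b a]y2C [y2 (corner b a) _]y2C addrC subrK.
- exists (- s); rewrite cab cba scalerBr !scaleNr scalerA ss1 scale1r opprK.
  by rewrite addrA subrr add0r.
- exists (- s); rewrite cab cba [y2 b a]y2C [y2 (corner b a) _]y2C scalerBr !scaleNr scalerA ss1.
  by rewrite scale1r opprK addrA subrr add0r.
Qed.

End Generators.

(** * The lower bound *)

Section LowerBound.
Variables (k : fieldType) (s : k).
Hypothesis ss1 : s * s = 1.
Local Notation T d := (dhomog 9 k d).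
Local Notation x c := ('X_(cell c) : {mpoly k[9]}).
Local Notation F := (cubic s).
Local Notation mulX := (@mulX k 8).

Local Notation y1 := (y1 k).
Local Notation y2 := (y2 k).
Local Notation y3 := (y3 k).
Local Notation gen := (gen s).

Lemma diff_act_y2 a b : (a < 9)%N -> (b < 9)%N -> diff_act (y2 a b) F = hessian s a b.
Proof. by move=> lta ltb; rewrite val_y2 diff_actM !diff_actXU mderiv_comm cubic_hessian. Qed.

Lemma gen_apolar v : diff_act (gen v) F = 0.
Proof.
rewrite /gen; case def_p: (pair_of v) => [[a b]|]; last by rewrite diff_act0.
have [lta ltb _] := pair_ofP def_p; case: ifPn => ab.
  by rewrite diff_act_y2 // /hessian ab.
have /and5P[ltc _ _ _ /and4P[/eqP cc thc cyc _]] := corner_facts lta ltb.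
have /and5P[ltd _ _ _ _] := corner_facts ltb lta.
have -> : mpoly_of_dhomog (y2 a b - s *: y2 (corner a b) (corner b a)) =
    mpoly_of_dhomog (y2 a b) + (- s) *: mpoly_of_dhomog (y2 (corner a b) (corner b a)).
  by rewrite scaleNr.
rewrite diff_actD diff_actZ !diff_act_y2 // /hessian cc (negPf ab).
move: thc cyc; rewrite (negPf ab) /= => /eqP -> /eqP ->.
rewrite scalerA -scalerDl.
by case: cyclic_pair; rewrite /= mulNr ?mulr1 ?ss1 subrr scale0r.
Qed.

(** The linear form obtained by differentiating the cubic along a quadric, as the
    row of its coefficients. *)
Definition hess_row (u : T 2) : 'rV[k]_9 := \row_e (diff_act u F)@_(U_(e)).

Lemma hess_row_is_linear : linear hess_row.
Proof.
by move=> a u v; apply/rowP=> e; rewrite !mxE diff_actD diff_actZ mcoeffD mcoeffZ.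
Qed.

HB.instance Definition _ := GRing.isLinear.Build k _ _ _ hess_row hess_row_is_linear.

(** The quadrics apolar to the cubic. *)
Definition apolar2 : {vspace T 2} := lker (linfun hess_row).

Lemma mem_apolar2 u : diff_act (mpoly_of_dhomog u) F = 0 -> u \in apolar2.
Proof.
move=> uF0; rewrite memv_ker lfunE; apply/eqP/rowP=> e.
by rewrite !mxE uF0 mcoeff0.
Qed.

Lemma sign_neq0 (b : bool) : (if b then 1 else s) != 0.
Proof.
case: b; first exact: oner_neq0.
by apply: contra_eq_neq ss1 => ->; rewrite mul0r eq_sym oner_eq0.
Qed.

(** The nine second derivatives of the cubic along transversal pairs of
    variables are the variables up to sign, hence every linear form is obtained and
    the dimension is [45 - 9]. *)
Lemma dim_apolar2 : \dim apolar2 = 36.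
Proof.
have := limg_ker_dim (linfun hess_row) fullv; rewrite capfv.
have -> : limg (linfun hess_row) = fullv.
  apply/eqP; rewrite eqEsubv subvf; apply/subvP=> w _.
  rewrite [w]row_sum_delta; apply: memv_suml => e _; apply: memvZ.
  have [c ltc ->] := cell_surj e.
  have /and4P[lta ltb ab /eqP ab_c] := opposite_facts ltc.
  set a := (opposite c).1 in lta ab ab_c; set b := (opposite c).2 in ltb ab ab_c.
  pose g := if cyclic_pair a b then 1 else s.
  suff -> : delta_mx 0 (cell c) = linfun hess_row (g^-1 *: y2 a b) by apply/memv_img/memvf.
  apply/rowP=> e'; rewrite lfunE !mxE /= diff_actZ diff_act_y2 // /hessian (negPf ab) ab_c -/g.
  by rewrite scalerA mulVf ?sign_neq0 // scale1r mcoeffXU eq_sym.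
rewrite (dim_dhomog k 8 2) dimvf -[dim _]/(1 * 9)%N => /eqP.
by rewrite (eqn_add2r 9 _ 36) => /eqP.
Qed.

Variable I : idealr {mpoly k[9]}.
Hypotheses (satI : saturated_ideal I) (apolarI : {subset I <= apolar_ideal F}).

(** The cubic depends essentially on all its variables. *)
Lemma ideal_part1_eq0 : ideal_part I 1 = 0%VS.
Proof.
apply/eqP; rewrite -subv0; apply/subvP=> u; rewrite mem_ideal_part => /apolarI/eqP uF0.
rewrite memv0; apply/eqP/val_inj.
rewrite /= T1_sum big1 // => i _; have [c ltc ->] := cell_surj i.
have /and4P[lta ltb ab /eqP ab_c] := opposite_facts ltc.
set a := (opposite c).1 in lta ab ab_c; set b := (opposite c).2 in ltb ab ab_c.
have : diff_act (y2 a b) (diff_act u F) = 0 by rewrite uF0 linear0.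
rewrite -diff_actM mulrC diff_actM diff_act_y2 // /hessian (negPf ab) ab_c.
rewrite linearZ /= => /eqP; rewrite scaler_eq0 (negPf (sign_neq0 _)) /=.
have -> : diff_act u (x c) = \sum_(j < 9) (val u)@_(U_(j)) *: diff_act 'X_j (x c).
  rewrite {1}[mpoly_of_dhomog u]T1_sum.
  elim/big_rec2: _ => [|j p q _ <-]; first exact: diff_act0.
  by rewrite diff_actD diff_actZ.
rewrite (bigD1 (cell c)) //= big1 ?addr0 => [|j ne_jc]; last first.
  have [d ltd def_j] := cell_surj j; rewrite def_j diff_actXU mderiv_cell //.
  have [dc|_] := eqVneq d c; first by rewrite def_j dc eqxx in ne_jc.
  by rewrite scaler0.
rewrite diff_actXU mderiv_cell // eqxx.
by rewrite scaler_eq0 oner_eq0 orbF => /eqP ->; rewrite scale0r.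
Qed.

(** The quadrics that are congruent modulo [I] to a combination of generators of
    weight less than [v]. *)
Definition lower v : {vspace T 2} := (ideal_part I 2 + <<[seq gen u | u <- iota 0 v]>>)%VS.

(** The weights of the generators that do not reduce modulo [I] to generators of
    smaller weight. Every weight of a generator is less than 49. *)
Definition removed := [seq v <- iota 0 49 | gen v \notin lower v].

Lemma lower_apolar v : (lower v <= apolar2)%VS.
Proof.
rewrite subv_add; apply/andP; split.
  by apply/subvP=> u; rewrite mem_ideal_part => /apolarI/eqP/mem_apolar2.
by apply/span_subvP=> _ /mapP[u _ ->]; apply/mem_apolar2/gen_apolar.
Qed.

(** These generators are independent modulo [I] among the apolar quadrics, and
    [36 - (45 - 13) = 4]. *)
Lemma size_removed : (codim_part I 2 <= 13)%N -> (size removed <= 4)%N.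
Proof.
move=> le_codim; rewrite -(leq_add2l (\dim (ideal_part I 2))).
rewrite -size_new_vectors -/(lower 49) (leq_trans (dimvS (lower_apolar 49))) // dim_apolar2.
by move: le_codim; rewrite /codim_part (dim_dhomog k 8 2) leq_subLR -(leq_add2r 9 36) -addnA.
Qed.

(** The cubics that are congruent modulo [I] to a combination of surviving
    monomials. *)
Definition survivors_span : {vspace T 3} :=
  (ideal_part I 3 + <<[seq y3 t.1 t.2.1 t.2.2 | t <- triples & survives removed t]>>)%VS.

Lemma mulX_lower c v :
  (c < 9)%N -> gen v \in lower v ->
  (forall a b, (a < 9)%N -> (b < 9)%N -> (pair_weight (a, b) < v)%N ->
    y3 c a b \in survivors_span) ->
  mulX 2 (cell c) (gen v) \in survivors_span.
Proof.
move=> ltc gv IH; rewrite memv_preim; apply: subvP gv.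
rewrite subv_add; apply/andP; split.
  apply/subvP=> u Iu; rewrite -memv_preim.
  by apply: subvP (mulX_ideal_part _ Iu); apply: addvSl.
apply/span_subvP=> _ /mapP[u + ->]; rewrite mem_iota /= -memv_preim => ltuv.
rewrite /gen; case def_p: (pair_of u) => [[a b]|]; last by rewrite linear0 mem0v.
have [lta ltb def_u] := pair_ofP def_p; case: ifPn => ab.
  by apply: IH; rewrite // def_u.
have /and5P[ltd _ _ /eqP wt_d _] := corner_facts lta ltb.
have /and5P[lte _ _ _ _] := corner_facts ltb lta.
rewrite linearB linearZ /=; apply: memvB; last apply: memvZ.
  by apply: IH; rewrite // def_u.
by apply: IH; rewrite // wt_d def_u.
Qed.

(** A monomial divisible by a monomial generator that is not removed reduces to
    monomials of smaller weight. *)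
Lemma survivors_span_divisible c a b : (c < 9)%N -> (a < 9)%N -> (b < 9)%N ->
  (forall t, [/\ t.1 < 9, t.2.1 < 9 & t.2.2 < 9]%N ->
    (triple_weight t < triple_weight (c, (a, b)))%N ->
    y3 t.1 t.2.1 t.2.2 \in survivors_span) ->
  ~~ all (fun v => v \in removed) (monomial_weights (c, (a, b))) -> y3 c a b \in survivors_span.
Proof.
move=> ltc lta ltb IH /allPn[v /mapP[[c' [a' b']]]].
rewrite mem_filter => /andP[/= ab' split_t] -> not_removed.
have pe := @mem_splits _ (c, (a, b)) split_t; rewrite (y3_perm k pe) /=.
have wt_eq : triple_weight (c, (a, b)) = (weight c' + pair_weight (a', b'))%N.
  by have /perm_sumn := perm_map weight pe; rewrite /triple_weight /pair_weight /= !addn0.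
have [ltc' lta' ltb'] : [/\ c' < 9, a' < 9 & b' < 9]%N.
  have := perm_all (gtn 9) pe; rewrite /= ltc lta ltb => /esym/and4P[-> -> ->] _.
  by [].
rewrite /y3 -(gen_collinear s lta' ltb' ab'); apply: mulX_lower => // [|d e ltd lte lt_w].
  have /and5P[_ lt49 _ _ _] := corner_facts lta' ltb'.
  by apply: contraR not_removed => not_lower; rewrite mem_filter not_lower mem_iota.
by apply: (IH (c', (d, e))) => //; rewrite wt_eq /triple_weight ltn_add2l.
Qed.

(** By induction on the weight, and then on the code of the sorted triple: a
    monomial that does not survive either is divisible by a monomial generator that
    is not removed, or has the same class up to sign and up to smaller weights as a
    neighbour that is smaller or divisible by such a generator. *)
Lemma survivors_span_full : survivors_span = fullv.
Proof.
apply: cubic_forms_generated.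
suff main w : forall t, [/\ t.1 < 9, t.2.1 < 9 & t.2.2 < 9]%N -> (triple_weight t < w)%N ->
    y3 t.1 t.2.1 t.2.2 \in survivors_span.
  by move=> a b c lta ltb ltc; apply: (main (triple_weight (a, (b, c))).+1 (a, (b, c))).
elim: w => // w IHw t [lta ltb ltc]; rewrite ltnS leq_eqVlt => /orP[/eqP wt_w|]; last exact: IHw.
have y3_sort a b c : let t' := triple_sort (a, (b, c)) in y3 t'.1 t'.2.1 t'.2.2 = y3 a b c.
  by move=> t'; rewrite /t'; have [a' [b' [c' [-> /(y3_perm k) ->]]]] := triple_sort_perm a b c.
suff sorted_in n : forall t, t \in triples -> triple_weight t = w -> (triple_code t < n)%N ->
    y3 t.1 t.2.1 t.2.2 \in survivors_span.
  case: t lta ltb ltc wt_w => a [b c] /= lta ltb ltc wt_w.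
  rewrite -y3_sort; apply: (sorted_in (triple_code (triple_sort (a, (b, c)))).+1) => //.
    exact: triple_sort_triples.
  by rewrite triple_weight_sort.
elim: n => // n IHn {lta ltb ltc wt_w}t t_in wt_w lt_tn.
have [lta ltb ltc] := mem_triples t_in; case: (boolP (survives removed t)) => [surv|].
  apply: subvP (addvSr _ _) _ _; apply: memv_span.
  by apply/mapP; exists t; rewrite // mem_filter surv.
have IHlt u : triple_weight u = w -> forall t, [/\ t.1 < 9, t.2.1 < 9 & t.2.2 < 9]%N ->
    (triple_weight t < triple_weight u)%N -> y3 t.1 t.2.1 t.2.2 \in survivors_span.
  by move=> -> {t_in wt_w lta ltb ltc lt_tn}t; apply: IHw.
case/not_survives=> [killed | [v [t' [nbr not_removed lt_or_killed]]]].
  case: t {t_in} lta ltb ltc killed wt_w {lt_tn} => a [b c] lta ltb ltc killed wt_w.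
  by apply: survivors_span_divisible => //; apply: IHlt.
case/mapP: nbr not_removed => [[c' [a' b']]]; rewrite mem_filter.
move=> /andP[/= ab' split_t] [-> def_t'] not_removed.
have pe := mem_splits split_t.
have wt_t : triple_weight t = (weight c' + pair_weight (a', b'))%N.
  by have /perm_sumn := perm_map weight pe; rewrite /triple_weight /pair_weight /= !addn0.
have [ltc' lta' ltb'] : [/\ c' < 9, a' < 9 & b' < 9]%N.
  have := perm_all (gtn 9) pe; rewrite /= lta ltb ltc => /esym/and4P[-> -> ->] _.
  by [].
have [e def_y2] := gen_noncollinear ss1 lta' ltb' ab'.
have /and5P[ltd lt49 _ /eqP wt_d _] := corner_facts lta' ltb'.
have /and5P[lte _ _ _ _] := corner_facts ltb' lta'.
have -> : y3 t.1 t.2.1 t.2.2 = mulX 2 (cell c') (y2 a' b') by rewrite (y3_perm k pe).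
rewrite def_y2 linearD !linearZ /=.
apply: memvD; apply: memvZ; last first.
  apply: mulX_lower => // [|a b lta1 ltb1 lt_w].
    by apply: contraR not_removed => not_lower; rewrite mem_filter not_lower mem_iota.
  by apply: (IHw (c', (a, b))) => //; rewrite -wt_w wt_t /triple_weight ltn_add2l.
have wt_t' : triple_weight t' = w.
  by rewrite def_t' triple_weight_sort /triple_weight wt_d -wt_w wt_t.
have t'_in : t' \in triples by rewrite def_t' triple_sort_triples.
have [lta1 ltb1 ltc1] := mem_triples t'_in.
have : y3 t'.1 t'.2.1 t'.2.2 \in survivors_span.
  case: lt_or_killed => [lt_t't | killed].
    by apply: IHn => //; apply: leq_trans lt_t't _.
  case: t' {t'_in def_t'} lta1 ltb1 ltc1 killed wt_t' => a [b c] lta1 ltb1 ltc1 killed wt_t'.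
  by apply: survivors_span_divisible => //; apply: IHlt.
by rewrite def_t' y3_sort.
Qed.

(** If [h 2 <= 13], then [9 = h 1 <= h 2 <= h 3 <= 8]. *)
Lemma codim_part_ge14 : (14 <= codim_part I 2)%N.
Proof.
rewrite leqNgt; apply/negP=> /size_removed le_removed.
have := leq_trans (leq_codim_partS 1 satI) (leq_codim_partS 2 satI).
rewrite leqNgt => /negP; apply.
rewrite {2}/codim_part ideal_part1_eq0 dimv0 subn0 (dim_dhomog k 8 1).
apply: (@leq_ltn_trans 8) => //; rewrite /codim_part leq_subLR -survivors_span_full.
apply: leq_trans (leq_of_leqif (dimv_add_leqif _ _)) _.
rewrite leq_add2l (leq_trans (dim_span _)) // size_map size_filter.
by apply: few_survivors => //; apply/filter_uniq/iota_uniq.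
Qed.
End LowerBound.

(** * The ideal of finitely many points *)

Local Open Scope quotient_scope.

(** A nonzero prime ideal of [k[t]] is maximal: if [r1] is prime and contains
    [u != 0], and [r2] contains [r1] and an element [g] outside [r1], then [r2]
    contains 1. *)
Lemma poly_prime_maximal (k : fieldType) (r1 r2 : {pred {poly k}}) u g :
  {subset r1 <= r2} ->
  (forall a v, v \in r1 -> a * v \in r1) ->
  (forall v w, v * w \in r1 -> (v \in r1) || (w \in r1)) ->
  (forall a v, v \in r2 -> a * v \in r2) ->
  (forall v w, v \in r2 -> w \in r2 -> v + w \in r2) ->
  u != 0 -> u \in r1 -> g \in r2 -> g \notin r1 -> 1 \in r2.
Proof.
move=> r12 r1M r1P r2M r2D + + r2g r1'g.
have [n] := ubnP (size u); elim: n u => // n IHn u le_un u_neq0 r1u.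
pose d := gcdp u g; have d_neq0 : d != 0 by rewrite gcdp_eq0 (negPf u_neq0).
have def_u : u = (u %/ d) * d by rewrite divpK ?dvdp_gcdl.
have r1'd : d \notin r1.
  by apply: contra r1'g => r1d; rewrite -(divpK (dvdp_gcdr u g)) r1M.
have := r1u; rewrite {1}def_u => /r1P; rewrite (negPf r1'd) orbF => r1e.
have [sz_d | sz_d] := leqP (size d) 1.
  have /Bezout_coprimepP[[a b] /= ab1] : coprimep u g.
    by rewrite coprimep_def eqn_leq sz_d size_poly_gt0.
  have /eqpP[[c1 c2] /= /andP[c1_neq0 c2_neq0] def_1] := ab1.
  have -> : 1 = (c2^-1 *: c1%:P) * (a * u + b * g).
    rewrite -scalerAl mul_polyC def_1 scalerA mulVf // scale1r //.
  by apply: (r2M); apply: (r2D); apply: (r2M) => //; apply: r12.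
have e_neq0 : u %/ d != 0.
  by apply: contra_neq u_neq0 => e0; rewrite def_u e0 mul0r.
apply: IHn r1e => //; apply: leq_trans (ltnSE le_un).
rewrite size_divp // ltn_subrL -subn1 subn_gt0 sz_d size_poly_gt0 //.
Qed.

Section IdealQuotient.
Variables (A : comNzRingType) (I : idealr A).
Local Notation pi := (\pi_{ideal_quot I}).

Lemma pi_quot0 : pi 0 = 0. Proof. exact: pi_zeror. Qed.
Lemma pi_quot1 : pi 1 = 1. Proof. exact: pi_oner. Qed.
Lemma pi_quotD a b : pi (a + b) = pi a + pi b. Proof. exact: pi_addr. Qed.
Lemma pi_quotM a b : pi (a * b) = pi a * pi b. Proof. exact: pi_mulr. Qed.

Lemma pi_quot_ideal a : a \in I -> pi a = 0.
Proof. by move=> Ia; apply/eqP; rewrite -pi_quot0 -Quotient.idealrBE subr0. Qed.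

(** The kernel of a morphism to a domain, as a prime ideal of a quotient ring. *)
Lemma quotient_prime (D : idomainType) (psi : {rmorphism A -> D}) :
  {in I, forall a, psi a = 0} ->
  exists Q : prime_idealr {ideal_quot I}, forall a, (pi a \in Q) = (psi a == 0).
Proof.
move=> psiI; pose q (x : {ideal_quot I}) := psi (generic_quotient.repr x) == 0.
have q_pi a : (pi a \in q) = (psi a == 0).
  rewrite [_ \in _]/(q _) /q.
  suff -> : psi a = psi (generic_quotient.repr (pi a)) by [].
  apply/eqP; rewrite -subr_eq0 -rmorphB; apply/eqP/psiI.
  by rewrite Quotient.idealrBE reprK.
have q_ideal : idealr_closed q.
  split=> [||x u v].
  - by rewrite -pi_quot0 q_pi rmorph0.
  - by rewrite -pi_quot1 q_pi rmorph1 oner_eq0.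
  - rewrite -[x]reprK -[u]reprK -[v]reprK !q_pi => /eqP u0 /eqP v0.
    by rewrite -pi_quotM -pi_quotD q_pi rmorphD rmorphM u0 v0 mulr0 addr0.
have q_prime : prime_idealr_closed q.
  move=> u v; rewrite -[u]reprK -[v]reprK -pi_quotM !q_pi.
  by rewrite rmorphM mulf_eq0.
pose Qi := isIdealr.Build _ q q_ideal.
pose Qp := isPrimeIdealrClosed.Build _ q q_prime.
exists (HB.pack_for (prime_idealr {ideal_quot I}) q Qi Qp).
by move=> a; rewrite -q_pi.
Qed.

End IdealQuotient.

Section Points.
Variables (k : fieldType) (n : nat).
Local Notation T := {mpoly k[n.+1]}.
Implicit Types (p q : 'rV[k]_n.+1) (P : seq 'rV[k]_n.+1) (theta : T).

(** Restriction to the line through [p]: the homogeneous components of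
    [theta], evaluated at [p], are the coefficients of [restrict p theta]. *)
Definition restrict p : T -> {poly k} := mmap (@polyC k) (fun i => (p 0 i)%:P * 'X).

HB.instance Definition _ p := GRing.RMorphism.on (restrict p).

Lemma restrictX p i : restrict p 'X_i = (p 0 i)%:P * 'X.
Proof. by rewrite /restrict mmapX mmap1U. Qed.

Lemma restrictZ p a theta : restrict p (a *: theta) = a *: restrict p theta.
Proof. by rewrite /restrict mmapZ mul_polyC. Qed.

Lemma restrictM p : {morph restrict p : f g / f * g}.
Proof. exact: rmorphM. Qed.

(** The value of a monomial at [p]. *)
Definition moneval p (m : 'X_{1..n.+1}) := \prod_i p 0 i ^+ m i.

Lemma restrict_monomial p m : restrict p 'X_[m] = (moneval p m)%:P * 'X^(mdeg m).
Proof.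
rewrite /restrict mmapX /mmap1 /moneval mdegE.
rewrite (eq_bigr (fun i => (p 0 i ^+ m i)%:P * 'X^(m i))) => [|i _].
  by rewrite big_split /= rmorph_prod prodrXr.
by rewrite exprMn rmorphXn.
Qed.

Lemma restrict_pihomog p d theta :
  restrict p (pihomog mdeg d theta) = (restrict p theta)`_d *: 'X^d.
Proof.
elim/mpolyind: theta => [|a m f _ _ IH].
  by rewrite linear0 !rmorph0 coef0 scale0r.
rewrite linearD linearZ /= !rmorphD /= {}IH coefD scalerDl; congr (_ + _).
rewrite !restrictZ coefZ pihomogX restrict_monomial coefCM coefXn eq_sym.
case: eqP => [->|_]; first by rewrite restrict_monomial mulr1 mul_polyC scalerA.
by rewrite rmorph0 !mulr0 scaler0 scale0r.
Qed.

(** The linear form dual to the point [p]. *)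
Definition linear_form p : T := \sum_i p 0 i *: 'X_i.

Lemma mderiv_linear_form p i : (linear_form p)^`M(i) = (p 0 i)%:MP.
Proof.
rewrite /linear_form raddf_sum (bigD1 i) //= big1 ?addr0 => [|j ne_ji].
  rewrite mderivZ mderivX mnm1E eqxx scale1r -[X in (X - _)%MM]add0m addmK mpolyX0.
  by rewrite alg_mpolyC.
by rewrite mderivZ mderivX mnm1E (negPf ne_ji) scale0r scaler0.
Qed.

Lemma mderiv_linear_formX p i d :
  (linear_form p ^+ d)^`M(i) = (p 0 i * d%:R) *: linear_form p ^+ d.-1.
Proof.
elim: d => [|d IHd]; first by rewrite expr0 mderivC mulr0 scale0r.
rewrite exprS mderivM mderiv_linear_form {}IHd mul_mpolyC -scalerAr -exprS /=.
case: d => [|d]; first by rewrite mulr0 scale0r addr0 mulr1.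
by rewrite -scalerDl -[d.+2%:R]natr1 mulrDr mulr1 addrC.
Qed.

Lemma diff_act_monomial_power p m d :
  diff_act 'X_[m] (linear_form p ^+ d) =
  (moneval p m * (d ^_ (mdeg m))%:R) *: linear_form p ^+ (d - mdeg m).
Proof.
have [N] := ubnP (mdeg m); elim: N m d => // N IHN m d lt_mN.
have [m0 | m_neq0] := eqVneq m 0%MM.
  rewrite m0 mpolyX0 -mpolyX0 diff_actX mderivm0m mdeg0 subn0 ffactn0 mulr1.
  by rewrite /moneval big1 ?scale1r // => i _; rewrite mnm0E expr0.
have [i mi] : exists i, m i != 0%N.
  apply/existsP; apply: contra_neqT m_neq0 => /existsPn m0.
  by apply/mnmP=> i; rewrite mnm0E; apply/eqP/negPn/m0.
have le_im : (U_(i) <= m)%MM by rewrite lep1mP.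
rewrite -(submK le_im) in lt_mN *; set m' := (m - U_(i))%MM in lt_mN *.
rewrite mdegD mdeg1 addn1 in lt_mN *.
rewrite mpolyXD diff_actM diff_actXU mderiv_linear_formX linearZ /=.
rewrite IHN // scalerA; congr (_ *: _ ^+ _); last by case: d => //= d; rewrite subSS.
have -> : moneval p (m' + U_(i)) = p 0 i * moneval p m'.
  rewrite /moneval (bigD1 i) //= [in RHS](bigD1 i) //= mulrA mnmDE mnm1E eqxx addn1 exprS.
  by congr (_ * _); apply: eq_bigr => j ne_ji; rewrite mnmDE mnm1E eq_sym (negPf ne_ji) addn0.
rewrite mulrACA; congr (_ * _); rewrite -natrM.
case: d => [|d]; first by rewrite mul0n ffact0n.
by rewrite ffactSS.
Qed.

(** The action on a power of a linear form is evaluation at the dual point,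
    degree by degree: this is the source of the apolarity lemma. *)
Lemma diff_act_power p theta d :
  diff_act theta (linear_form p ^+ d) =
  \sum_(e < d.+1) ((restrict p theta)`_e * (d ^_ e)%:R) *: linear_form p ^+ (d - e).
Proof.
elim/mpolyind: theta => [|a m f _ _ IH].
  by rewrite diff_act0 big1 // => e _; rewrite rmorph0 coef0 mul0r scale0r.
rewrite diff_actD diff_actZ {}IH diff_act_monomial_power rmorphD /= restrictZ restrict_monomial.
under [RHS]eq_bigr do rewrite coefD coefZ coefCM coefXn mulrDl scalerDl.
rewrite big_split /=; congr (_ + _).
have [le_md | lt_dm] := leqP (mdeg m) d.
  rewrite (bigD1 (Ordinal (le_md : (mdeg m < d.+1)%N))) //= eqxx mulr1.
  rewrite big1 ?addr0 ?scalerA ?mulrA // => e.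
  by rewrite -val_eqE /= => /negPf->; rewrite !mulr0 mul0r scale0r.
rewrite ffact_small // mulr0 scale0r scaler0 big1 // => e _.
have -> : (e == mdeg m :> nat) = false by apply: ltn_eqF; apply: leq_trans lt_dm.
by rewrite !mulr0 mul0r scale0r.
Qed.

(** Forms vanishing at [p] annihilate all powers of the linear form dual to [p]. *)
Lemma diff_act_power_eq0 p theta d :
  restrict p theta = 0 -> diff_act theta (linear_form p ^+ d) = 0.
Proof.
by move=> th0; rewrite diff_act_power big1 // => e _; rewrite th0 coef0 mul0r scale0r.
Qed.

(** The forms vanishing at the points of [P]: membership is tested on the
    restrictions to the lines through these points, so that the ideal is homogeneous.
    It is proper as soon as [P] is nonempty. *)
Definition vanishing P : {pred T} := fun theta => all (fun p => restrict p theta == 0) P.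

Lemma vanishingP P theta :
  reflect (forall p, p \in P -> restrict p theta = 0) (theta \in vanishing P).
Proof. by apply: (iffP allP) => th0 p /th0/eqP. Qed.

Lemma vanishing_idealr_closed P : P != [::] -> idealr_closed (vanishing P).
Proof.
move=> P_neq0; split=> [||a u v /vanishingP u0 /vanishingP v0].
- by apply/vanishingP=> p _; rewrite rmorph0.
- case: P P_neq0 => // p P _; apply/negP=> /vanishingP/(_ p (mem_head _ _))/eqP.
  by rewrite rmorph1 oner_eq0.
- by apply/vanishingP=> p Pp; rewrite rmorphD rmorphM /= u0 // v0 // mulr0 addr0.
Qed.

Definition points_ideal P (P_neq0 : P != [::]) : idealr T :=
  HB.pack_for (idealr T) (vanishing P : T -> bool)
    (isIdealr.Build T (vanishing P) (vanishing_idealr_closed P_neq0)).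

Section PointsIdeal.
Variables (P : seq 'rV[k]_n.+1) (P_neq0 : P != [::]).
Local Notation I := (points_ideal P_neq0).

Lemma points_idealP theta :
  reflect (forall p, p \in P -> restrict p theta = 0) (theta \in I).
Proof. exact: vanishingP. Qed.

Lemma points_ideal_homogeneous : homogeneous_ideal I.
Proof.
move=> theta /points_idealP th0 d; apply/points_idealP=> p Pp.
by rewrite restrict_pihomog th0 // coef0 scale0r.
Qed.

Hypothesis P_pts : 0 \notin P.

Lemma point_coord p : p \in P -> exists i, p 0 i != 0.
Proof.
move=> Pp; apply/existsP; apply: contraR P_pts => /existsPn p0.
suff <- : p = 0 by [].
by apply/rowP=> i; rewrite mxE; apply/eqP/negPn/p0.
Qed.

Lemma points_ideal_saturated : saturated_ideal I.
Proof.
move=> theta [N thN]; apply/points_idealP=> p Pp; have [i pi0] := point_coord Pp.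
have /points_idealP/(_ p Pp)/eqP : 'X_[U_(i) *+ N] * theta \in I.
  by apply: thN; rewrite mdegMn mdeg1 mul1n.
rewrite restrictM mulf_eq0 => /orP[|/eqP //].
by rewrite -mpolyXn rmorphXn /= restrictX expf_eq0 mulf_eq0 polyC_eq0 polyX_eq0 (negPf pi0) andbF.
Qed.

(** Linear dependence of two vectors: all the 2 x 2 minors vanish. *)
Definition proportional p q := [forall i, forall j, p 0 i * q 0 j == p 0 j * q 0 i].

Hypothesis P_distinct : forall p q, p \in P -> q \in P -> proportional p q -> p = q.
Hypothesis P_uniq : uniq P.

Lemma separating_form p q : p \in P -> q \in P -> p != q ->
  exists l c, [/\ restrict p l = 0, c != 0 & restrict q l = c%:P * 'X].
Proof.
move=> Pp Pq ne_pq; have : ~~ proportional p q.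
  by apply: contra ne_pq => /P_distinct->.
case/forallPn=> i /forallPn[j]; rewrite -subr_eq0 => ne0.
exists (p 0 i *: 'X_j - p 0 j *: 'X_i), (p 0 i * q 0 j - p 0 j * q 0 i).
rewrite !rmorphB /= !restrictZ !restrictX -!mul_polyC !mulrA -!polyCM.
by split; rewrite -?mulrBl -?polyCB // [X in X - _]mulrC subrr polyC0 mul0r.
Qed.

(** A polynomial that vanishes at all the points but one, where its component of a
    given large degree does not vanish. *)
Lemma interpolating_form q d : q \in P -> (size P <= d)%N ->
  exists f, (restrict q f)`_d != 0 /\
    forall p, p \in P -> p != q -> restrict p f = 0.
Proof.
move=> Pq le_Pd; have [i qi] := point_coord Pq.
suff gen ps e : (size ps <= e)%N -> {subset ps <= P} -> exists f c,
    [/\ c != 0, restrict q f = c%:P * 'X^e & forall p, p \in ps -> p != q -> restrict p f = 0].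
  have [//|f [c [c0 fq fp]]] := gen P d le_Pd.
  by exists f; rewrite fq coefCM coefXn eqxx mulr1.
elim: ps e => [|p ps IHps] e.
  move=> _ _; exists ('X_i ^+ e), (q 0 i ^+ e); split=> //; first by rewrite expf_neq0.
  by rewrite rmorphXn /= restrictX exprMn rmorphXn.
case: e => // e le_e sub_ps.
have [f [c [c0 fq fp]]] := IHps e le_e (fun x xps => sub_ps x (mem_behead (s := p :: ps) xps)).
have Pp : p \in P by apply: sub_ps; rewrite mem_head.
have [eq_pq | ne_pq] := eqVneq p q.
  exists ('X_i * f), (q 0 i * c); rewrite mulf_neq0 // restrictM restrictX fq.
  split=> //; first by rewrite mulrACA -polyCM -exprS.
  move=> p'; rewrite inE => /orP[/eqP-> | ps_p'] ne_p'q; first by rewrite eq_pq eqxx in ne_p'q.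
  by rewrite restrictM fp // mulr0.
have [l [c' [lp c'0 lq]]] := separating_form Pp Pq ne_pq.
exists (l * f), (c' * c); rewrite mulf_neq0 // restrictM lq fq.
split=> //; first by rewrite mulrACA -polyCM -exprS.
move=> p'; rewrite inE => /orP[/eqP-> | ps_p'] ne_p'q; first by rewrite restrictM lp mul0r.
by rewrite restrictM fp // mulr0.
Qed.

(** In degrees at least [size P], evaluation at the points is onto. *)
Lemma points_codim d : (size P <= d)%N -> codim_part I d = size P.
Proof.
move=> le_Pd.
pose ev (u : dhomog n.+1 k d) : 'rV[k]_(size P) := \row_j (restrict P`_j (mpoly_of_dhomog u))`_d.
have ev_lin : linear ev.
  by move=> a u v; apply/rowP=> j; rewrite !mxE rmorphD /= restrictZ coefD coefZ.
pose evL := GRing.isLinear.Build k _ _ _ ev ev_lin.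
pose evf : {linear dhomog n.+1 k d -> 'rV[k]_(size P)} := HB.pack ev evL.
have restrict_dhomog p (u : dhomog n.+1 k d) : restrict p u = (restrict p u)`_d *: 'X^d.
  by rewrite -restrict_pihomog pihomog_dE ?dhomog_is_dhomog.
have -> : codim_part I d = \dim (limg (linfun evf)).
  rewrite /codim_part -(limg_ker_dim (linfun evf) fullv) capfv.
  suff -> : ideal_part I d = lker (linfun evf) by rewrite addKn.
  apply/vspaceP=> u; rewrite mem_ideal_part memv_ker lfunE.
  apply/points_idealP/eqP => [u0 | /rowP u0 p Pp].
    by apply/rowP=> j; rewrite !mxE u0 ?coef0 // mem_nth.
  have := u0 (Ordinal (etrans (index_mem p P) Pp : index p P < size P)%N).
  by rewrite !mxE nth_index // => up0; rewrite restrict_dhomog up0 scale0r.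
suff -> : limg (linfun evf) = fullv by rewrite dimvf /dim /= mul1n.
apply/eqP; rewrite eqEsubv subvf; apply/subvP=> w _.
rewrite [w]row_sum_delta; apply: memv_suml => j _; apply: memvZ.
have Pj : P`_j \in P by rewrite mem_nth.
have [f [fj f0]] := interpolating_form Pj le_Pd.
pose u : dhomog n.+1 k d := DHomog (pihomogP mdeg d f).
suff -> : delta_mx 0 j = linfun evf (((restrict P`_j f)`_d)^-1 *: u) by apply/memv_img/memvf.
apply/rowP=> i; rewrite lfunE !mxE /= restrictZ coefZ restrict_pihomog coefZ coefXn eqxx mulr1.
have [-> | ne_ij] := eqVneq i j; first by rewrite mulVf.
have fi0 : restrict P`_i f = 0 by apply: f0; rewrite ?mem_nth // nth_uniq.
by rewrite fi0 coef0 mulr0 ?andbF.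
Qed.

Lemma points_hilbert_poly : hilbert_poly I ((size P)%:R)%:P.
Proof.
exists (size P) => d le_Pd; exists (size P); last by rewrite hornerC.
exists (ideal_part I d); first by move=> u; rewrite mem_ideal_part.
by rewrite -[LHS](points_codim le_Pd).
Qed.

(** A right inverse of [restrict p], when the [i]-th coordinate of [p] is nonzero. *)
Definition lift_line p i : {poly k} -> T := horner_alg ((p 0 i)^-1 *: 'X_i).

HB.instance Definition _ p i := GRing.RMorphism.on (lift_line p i).

Lemma lift_lineK p i : p 0 i != 0 -> cancel (lift_line p i) (restrict p).
Proof.
move=> pi0; elim/poly_ind => [|u c IH]; first by rewrite !rmorph0.
rewrite !rmorphD !rmorphM /= {}IH; congr (_ * _ + _).
  by rewrite /lift_line horner_algX restrictZ restrictX -mul_polyC mulrA -polyCM mulVf ?mul1r.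
by rewrite /lift_line horner_algC -mul_mpolyC mulr1 /restrict mmapC.
Qed.

(** The chain of length one consists of the ideal of a point and the irrelevant
    ideal. In a chain of length two, the smallest prime contains the ideal of a point,
    so that the chain comes from one in [k[t]]. *)
Lemma points_krull_dim : krull_dim {ideal_quot I} 1.
Proof.
split.
  have [p Pp] : exists p, p \in P by case: P P_neq0 => // p; exists p; rewrite mem_head.
  have [i pi0] := point_coord Pp.
  have Ip : {in I, forall f, restrict p f = 0} by move=> f /points_idealP; apply.
  have [Q0 memQ0] := quotient_prime Ip.
  pose at0 := [the {rmorphism T -> k} of horner_eval 0 \o restrict p].
  have [|Q1 memQ1] := @quotient_prime _ I _ at0.
    by move=> f /Ip fp; rewrite /= fp rmorph0.
  exists (fun j => if j == 0 :> 'I_2 then Q0 else Q1) => i1 j1.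
  case: i1 j1 => [[|[|?]] ?] [[|[|?]] ?] //= _; split.
    move=> x; rewrite -[x]reprK memQ0 memQ1 => /eqP xp.
    by rewrite /= xp rmorph0.
  move=> /(_ (\pi_{ideal_quot I} ('X_i : T))); rewrite memQ0 memQ1 /= restrictX /horner_eval hornerCM hornerX mulr0 eqxx.
  by move=> /(_ isT); rewrite mulf_eq0 polyC_eq0 polyX_eq0 (negPf pi0).
move=> m [Q chainQ]; rewrite leqNgt; apply/negP=> lt1m.
pose Q0 := Q (inord 0); pose Q1 := Q (inord 1); pose Q2 := Q (inord 2).
have [Q01 /existsNP[x /not_implyP[Q1x /negP Q0'x]]] : {subset Q0 <= Q1} /\ ~ {subset Q1 <= Q0}.
  by apply: chainQ; rewrite !inordK // ltnS ltnW.
have [Q12 /existsNP[y /not_implyP[Q2y /negP Q1'y]]] : {subset Q1 <= Q2} /\ ~ {subset Q2 <= Q1}.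
  by apply: chainQ; rewrite !inordK // ltnS ltnW.
rewrite -[x]reprK -[y]reprK in Q1x Q0'x Q2y Q1'y.
set f := generic_quotient.repr x in Q1x Q0'x; set g := generic_quotient.repr y in Q2y Q1'y.
(* A prime containing the product of the ideals of the points contains one of them. *)
have [p Pp kerQ0] : exists2 p, p \in P &
    forall theta, restrict p theta = 0 -> \pi_{ideal_quot I} theta \in Q0.
  apply: contrapT => noP; suff [h hP Q0'h] : exists2 h : T, {in P, forall p, restrict p h = 0} &
      \pi_{ideal_quot I} h \notin Q0.
    by case/negP: Q0'h; rewrite pi_quot_ideal ?rpred0 //; apply/points_idealP.
  have: {subset P <= P} by []; elim: {1 3}P => [|p ps IHps] sub_ps.
    by exists 1; rewrite // pi_quot1 idealr1.
  have [h hps Q0'h] := IHps (fun z zps => sub_ps z (mem_behead (s := p :: ps) zps)).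
  have /existsNP[h' /not_implyP[h'p /negP Q0'h']] : ~ forall theta, restrict p theta = 0 ->
      \pi_{ideal_quot I} theta \in Q0.
    by move=> kerQ0; apply: noP; exists p; rewrite // sub_ps ?mem_head.
  exists (h' * h) => [z|]; last by rewrite pi_quotM prime_idealrM negb_or Q0'h' Q0'h.
  by rewrite inE restrictM => /orP[/eqP->|/hps->]; rewrite ?h'p ?mul0r ?mulr0.
have [i pi0] := point_coord Pp; pose tau := lift_line p i.
have tauQ (R : idealr {ideal_quot I}) theta : {subset Q0 <= R} ->
    (\pi_{ideal_quot I} (tau (restrict p theta)) \in R) = (\pi_{ideal_quot I} theta \in R).
  move=> sub0R; have : \pi_{ideal_quot I} (theta - tau (restrict p theta)) \in R.
    by apply/sub0R/kerQ0; rewrite rmorphB /= lift_lineK ?subrr.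
  move=> Rdiff; rewrite -[theta in RHS](subrK (tau (restrict p theta))) pi_quotD.
  by rewrite rpredDl.
have Q02 : {subset Q0 <= Q2} by move=> z /Q01/Q12.
pose r (R : idealr {ideal_quot I}) : {pred {poly k}} := fun u => \pi_{ideal_quot I} (tau u) \in R.
have rM (R : idealr {ideal_quot I}) a v : v \in r R -> a * v \in r R.
  by rewrite !unfold_in /r /tau rmorphM pi_quotM; apply: idealMr.
have rD (R : idealr {ideal_quot I}) v w : v \in r R -> w \in r R -> v + w \in r R.
  move=> rv rw; rewrite unfold_in /r /tau rmorphD pi_quotD.
  exact: (rpredD (rv : \pi_{ideal_quot I} (tau v) \in R) (rw : \pi_{ideal_quot I} (tau w) \in R)).
have : 1 \in r Q2.
  apply: (@poly_prime_maximal k (r Q1) (r Q2) (restrict p f) (restrict p g)).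
  - by move=> v; rewrite !unfold_in; apply: Q12.
  - exact: rM.
  - by move=> v w; rewrite !unfold_in /r /tau rmorphM pi_quotM; apply: prime_idealr_closed_subproof.
  - exact: rM.
  - exact: rD.
  - by apply: contra Q0'x => /eqP /kerQ0.
  - by rewrite unfold_in /r tauQ.
  - by rewrite unfold_in /r tauQ.
  - by rewrite unfold_in /r tauQ.
by rewrite unfold_in /r /tau rmorph1 pi_quot1 idealr1.
Qed.

End PointsIdeal.

(** Any family of vectors is covered, up to scalars, by at most as many nonzero
    vectors, no two of which are proportional. *)
Lemma distinct_points (ps : seq 'rV[k]_n.+1) : exists P : seq 'rV[k]_n.+1,
  [/\ 0 \notin P, uniq P, (forall p q, p \in P -> q \in P -> proportional p q -> p = q),
      (size P <= size ps)%N &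
      forall p, p \in ps -> p = 0 \/ exists2 q, q \in P & exists a, p = a *: q].
Proof.
elim: ps => [|p ps [P [P0 P_uniq P_dist le_P cover]]]; first by exists [::].
have [p0 | p_neq0] := eqVneq p 0.
  exists P; split=> //; first exact: leqW.
  by move=> p'; rewrite inE => /orP[/eqP ->|/cover]; [left|].
have [/hasP[q Pq /forallP pq] | /hasPn not_prop] := boolP (has (proportional p) P).
  exists P; split=> //; first exact: leqW.
  move=> p'; rewrite inE => /orP[/eqP ->|/cover //]; right; exists q => //.
  have [j qj] : exists j, q 0 j != 0.
    apply/existsP; apply: contraR P0 => /existsPn q0.
    suff <- : q = 0 by [].
    by apply/rowP=> j; rewrite mxE; apply/eqP/negPn/q0.
  exists (p 0 j / q 0 j); apply/rowP=> i; rewrite mxE.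
  have /forallP/(_ j)/eqP e := pq i.
  by rewrite mulrAC -e mulfK.
have propC q q' : proportional q q' -> proportional q' q.
  move=> /forallP qq'; apply/forallP=> i; apply/forallP=> j.
  by have /forallP/(_ i)/eqP e := qq' j; rewrite mulrC e mulrC.
exists (p :: P); split=> //=.
- by rewrite inE negb_or eq_sym p_neq0.
- rewrite P_uniq andbT; apply/negP=> /not_prop/negP; apply.
  by apply/forallP=> i; apply/forallP=> j; rewrite mulrC.
- move=> q q'; rewrite !inE => /orP[/eqP->|Pq] /orP[/eqP->|Pq'] // prop.
  + by case/negP: (not_prop _ Pq').
  + by case/negP: (not_prop _ Pq); apply: propC.
  + exact: P_dist.
- move=> p'; rewrite inE => /orP[/eqP->|/cover[]]; [|by left|].
    by right; exists p; rewrite ?mem_head //; exists 1; rewrite scale1r.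
  by case=> q Pq pq; right; exists q; rewrite // inE Pq orbT.
Qed.

Lemma linear_formZ a p : linear_form (a *: p) = a *: linear_form p.
Proof.
by rewrite /linear_form scaler_sumr; apply: eq_bigr => i _; rewrite mxE scalerA.
Qed.

Lemma homog1_linear_form (l : T) : l \is 1.-homog -> l = linear_form (\row_i l@_(U_(i))).
Proof.
move=> l1; apply/mpolyP=> m; rewrite /linear_form raddf_sum /=.
have [/eqP/mdeg1P[j /eqP->] | ne1] := eqVneq (mdeg m) 1%N.
  rewrite (bigD1 j) //= mxE mcoeffZ mcoeffXU eqxx mulr1 big1 ?addr0 // => i ne_ij.
  by rewrite mcoeffZ mcoeffXU (negPf ne_ij) mulr0.
rewrite (dhomog_nemf_coeff l1) // big1 // => i _; rewrite mcoeffZ mcoeffX.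
by case: eqP => [def_m|_]; [rewrite -def_m mdeg1 in ne1 | rewrite mulr0].
Qed.

End Points.

(** * Comparison of the two ranks *)

Lemma leo_least (P1 P2 : nat -> Prop) :
  (forall r, P1 r -> exists2 r', (r' <= r)%N & P2 r') -> leo (least P2) (least P1).
Proof.
move=> P12; rewrite /least; case: pselect => [e2 | n2]; case: pselect => [e1 | n1] //=.
  case: ex_minnP => r2 _ min2; case: ex_minnP => r1 /asboolP/P12[r' le_r' Pr'] _.
  by apply: leq_trans le_r'; apply: min2; apply/asboolP.
have [r1 /asboolP/P12[r' _ Pr']] := e1.
by case: n2; exists r'; apply/asboolP.
Qed.

(** The linear forms of a Waring decomposition, without zeros and repetitions up to
    scalars, are the points of an apolar scheme. *)
Lemma cactus_rank_le_waring_rank (k : fieldType) (n d : nat) (F : {mpoly k[n.+1]}) :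
  F != 0 -> (0 < d)%N -> leo (cactus_rank F) (waring_rank d F).
Proof.
move=> F_neq0 d_gt0; apply: leo_least => r [c [l [l1 def_F]]].
pose v i : 'rV[k]_n.+1 := \row_j (l i)@_(U_(j)).
have [P [P0 P_uniq P_dist le_P cover]] := distinct_points [seq v i | i : 'I_r].
rewrite size_map -cardE card_ord in le_P.
have apolar theta : theta \in vanishing P -> diff_act theta F = 0.
  move=> /vanishingP th0; rewrite def_F linear_sum big1 // => i _.
  rewrite linearZ /= [l i]homog1_linear_form // -/(v i).
  have [->|[q Pq [a ->]]] := cover (v i) (map_f _ (mem_enum _ i)).
    by rewrite -[0 : 'rV_ _](scale0r 0) linear_formZ scale0r expr0n gtn_eqF // linear0 scaler0.
  by rewrite linear_formZ exprZn linearZ /= diff_act_power_eq0 ?th0 // !scaler0.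
have P_neq0 : P != [::].
  apply: contra_neq F_neq0 => defP; rewrite -[F]mderivm0m -diff_actX mpolyX0.
  by apply: apolar; rewrite defP.
exists (size P) => //; exists (points_ideal P_neq0); split.
- exact: points_ideal_homogeneous.
- exact: points_ideal_saturated.
- by move=> theta th_in; apply/eqP/apolar.
- exact: points_krull_dim.
- exact: points_hilbert_poly.
Qed.

(** * The bounds for the determinant and the permanent *)

Lemma cubic_neq0 (k : fieldType) (s : k) : cubic s != 0.
Proof.
have : hessian s 0 4 != 0.
  rewrite /hessian scale1r; apply/eqP=> /(congr1 (mcoeff U_(cell (third 0 4)))).
  by rewrite mcoeffXU eqxx mcoeff0 => /eqP; rewrite oner_eq0.
by apply: contra_neq => F0; rewrite -cubic_hessian // F0 !mderiv0.
Qed.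

Lemma cactus_rank_cubic_ge14 (k : fieldType) (s : k) :
  s * s = 1 -> leo (Some 14) (cactus_rank (cubic s)).
Proof.
move=> ss1; rewrite /cactus_rank /least; case: pselect => //= e.
case: ex_minnP => r /asboolP[I [_ satI apolarI _ hilbI]] _.
exact: leq_trans (codim_part_ge14 ss1 satI apolarI) (codim_part_le_degree 2 satI hilbI).
Qed.

Theorem theorem7 (k : fieldType)
    (char_k : [pchar k]%R =i pred0 \/
              exists2 p : nat, p \in [pchar k]%R & (3 < p)%N) :
  (leo (cactus_rank (det3 k)) (waring_rank 3 (det3 k)) /\
   leo (Some 14) (cactus_rank (det3 k))) /\
  (leo (cactus_rank (per3 k)) (waring_rank 3 (per3 k)) /\
   leo (Some 14) (cactus_rank (per3 k))).
Proof.
rewrite det3_cubic per3_cubic; split; split.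
- by apply: cactus_rank_le_waring_rank => //; apply: cubic_neq0.
- by apply: cactus_rank_cubic_ge14; rewrite mulrNN mulr1.
- by apply: cactus_rank_le_waring_rank => //; apply: cubic_neq0.
- by apply: cactus_rank_cubic_ge14; rewrite mulr1.
Qed.
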